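(* Let $K \subset \mathbb{R}^{2}$ be a Borel set which is not contained on a line. Then the set of unit vectors spanned by $K$, namely $$S(K) := \left\{\tfrac{x - y}{|x - y|} \in S^{1} : x,y \in K \text{ and } x \neq y\right\},$$ satisfies $\dim_{\mathrm{H}} S(K) \geq \tfrac{1}{2}\dim_{\mathrm{H}} K$.
   Context: $\dim_{\mathrm{H}}$ denotes Hausdorff dimension. *)

(* Defs.v *)
From HB Require Import structures.
From mathcomp Require Import all_boot all_order all_algebra.
From mathcomp Require Import all_classical all_reals all_analysis.
Import Order.TTheory GRing.Theory Num.Theory.
Import numFieldNormedType.Exports.

Set Implicit Arguments.
Unset Strict Implicit.
Unset Printing Implicit Defensive.

Local Open Scope classical_set_scope.
Local Open Scope ring_scope.

(* The library norm on 'rV[R]_n is the sup norm; the Euclidean one is needed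
   here. Both induce the same topology. *)
Definition eucl_norm (R : realType) (n : nat) (v : 'rV[R]_n) : R :=
  Num.sqrt (\sum_(i < n) v 0 i ^+ 2).

(* Adjoining 0 makes the diameter of the empty set 0 instead of -oo. *)
Definition diameter (R : realType) (n : nat) (A : set 'rV[R]_n) : \bar R :=
  ereal_sup (0%E |` [set (eucl_norm (p.1 - p.2))%:E | p in A `*` A]).

(* The empty set gets weight 0 even for s = 0, where 0 `^ 0 = 1. *)
Definition diameter_pow (R : realType) (n : nat) (s : R) (A : set 'rV[R]_n) :
    \bar R :=
  if A == set0 then 0%E else (diameter A `^ s)%E.

Definition countable_cover (R : realType) (n : nat) (delta : R)
    (A : set 'rV[R]_n) : set (nat -> set 'rV[R]_n) :=
  [set U | A `<=` \bigcup_k U k /\ forall k, (diameter (U k) <= delta%:E)%E].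

Definition hausdorff_premeasure (R : realType) (n : nat) (s delta : R)
    (A : set 'rV[R]_n) : \bar R :=
  ereal_inf [set (\sum_(0 <= k <oo) diameter_pow s (U k))%E
            | U in countable_cover delta A].

Definition hausdorff_measure (R : realType) (n : nat) (s : R)
    (A : set 'rV[R]_n) : \bar R :=
  ereal_sup [set hausdorff_premeasure s delta A | delta in [set d : R | 0 < d]].

Definition hausdorff_dim (R : realType) (n : nat) (A : set 'rV[R]_n) : \bar R :=
  ereal_inf [set s%:E | s in [set s : R | 0 <= s /\ hausdorff_measure s A = 0%E]].

Definition borel_set (T : topologicalType) (A : set T) : Prop :=
  <<s [set U : set T | open U] >> A.

Definition line (R : realType) (n : nat) (a v : 'rV[R]_n) : set 'rV[R]_n :=
  [set a + t *: v | t in [set: R]].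

Definition is_line (R : realType) (n : nat) (L : set 'rV[R]_n) : Prop :=
  exists a v : 'rV[R]_n, v != 0 /\ L = line a v.

Definition spanned_directions (R : realType) (n : nat) (K : set 'rV[R]_n) :
    set 'rV[R]_n :=
  [set e | exists x y, [/\ K x, K y, x != y &
                          e = (eucl_norm (x - y))^-1 *: (x - y)]].

(* Main.v *)
(* Let t < s/2 with H^t(S(K)) = 0 and H^s(K) > 0; the claim is a contradiction.
   If some line meets K in a set of positive H^s measure, project that set
   radially from a point of K off the line: the projection is locally
   bi-Lipschitz there, so S(K) has dimension at least s.

   Otherwise no line is charged.  A Frostman measure mu on a compact part of K is
   approximated by finitely many weighted points of K at a fine dyadic scale.
   Cover S(K) by arcs and sort them into scales r_i with r_(i+1) = r_i^(1+e), so
   that there are at most r_(i+1)^(-t) arcs of scale r_i.  If the pairs (x, y)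
   with direction in the arcs of scale r_i had mass g, Cauchy-Schwarz would give
   triples (x, y, z) of mass g^2 such that x and y both see z through these arcs.
   For fixed x, y not nearly collinear with z, such z lie in r_i^(-2(1+e)t) small
   balls, of negligible total mass because 2t < s.  Hence almost all these pairs
   lie in a common thin strip, of width v_i = r_i^e, with mass at least
   m_i = b^2 4^(-i).  There are O(1/m_i) essentially different heavy strips, and
   one whose thickening to width v_(i-1) has mass less than m_(i-1) = 4 m_i only
   carries O(m_i^2) pairs; so the heavy pairs new at scale i have mass O(m_i).
   As no line is charged, no strip of width v_0 is heavy once r_0 is small, and
   summing over i leaves most pairs without an arc covering their direction.

   The compact part of K comes from Choquet's capacitability theorem for the
   dyadic net content.  Only finite approximations are used, so no measure on K
   is ever constructed. *)

Require Import Defs.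
From HB Require Import structures.
From mathcomp Require Import all_boot all_order all_algebra.
From mathcomp Require Import all_classical all_reals all_analysis.
From mathcomp Require Import ring lra zify.
Import Order.TTheory GRing.Theory Num.Theory.
Import numFieldNormedType.Exports.

Set Implicit Arguments.
Unset Strict Implicit.
Unset Printing Implicit Defensive.

Local Open Scope classical_set_scope.
Local Open Scope ring_scope.

(** * Dyadic net content *)

Section NetContent.
Context (R : realType) (X : Type) (C : eqType) (q : nat -> X -> C) (rho : R).
Hypothesis rho_ge0 : 0 <= rho.
Hypothesis q_nested : forall k x y, q k.+1 x = q k.+1 y -> q k x = q k y.

Definition cost (l : seq (nat * C)) : R := \sum_(a <- l) rho ^+ a.1.

(** Testing only finite duplicate-free lists gives a meaning to the total cost of an infinite family
    without any summability. *)
Definition cost_le (W : set (nat * C)) (B : R) :=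
  forall l, uniq l -> (forall a, a \in l -> W a) -> cost l <= B.

Definition cell_cover (W : set (nat * C)) (E : set X) :=
  forall x, E x -> exists k, W (k, q k x).

(** For dyadic squares and [rho] = 2^(-s) this is the [s]-dimensional dyadic net content: a square
    of side 2^(-k) costs 2^(-ks). *)
Definition net_content (E : set X) : R :=
  inf [set B | exists W, cell_cover W E /\ cost_le W B].

(** The maximal cells of [W]: no point lies in two of them, and by nestedness they cover what [W]
    covers. *)
Definition coarsest (W : set (nat * C)) : set (nat * C) :=
  [set a | W a /\ forall j x, (j < a.1)%N -> q a.1 x = a.2 -> ~ W (j, q j x)].

Lemma q_nested_le j k x y : (j <= k)%N -> q k x = q k y -> q j x = q j y.
Proof.
move=> /subnK <-; elim: (k - j)%N => [//|n IH].
by rewrite addSn => /q_nested /IH.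
Qed.

Lemma cost_le_sub W W' B : W `<=` W' -> cost_le W' B -> cost_le W B.
Proof. by move=> sW cW l ul lW; apply: cW => // a /lW /sW. Qed.

Lemma cost_le_trans W B B' : B <= B' -> cost_le W B -> cost_le W B'.
Proof. by move=> BB cW l ul lW; apply: le_trans BB; apply: cW. Qed.

Lemma cell_cover_coarsest W E : cell_cover W E -> cell_cover (coarsest W) E.
Proof.
move=> cW x Ex; have /cW exk := Ex.
have exk' : exists k, `[< W (k, q k x) >].
  by case: exk => k Wk; exists k; apply/asboolP.
exists (ex_minn exk'); case: ex_minnP => k /asboolP Wk kmin; split => // j y /= jk.
move=> /(q_nested_le (ltnW jk)) -> Wj.
by have := kmin j (asboolT Wj); rewrite leqNgt jk.
Qed.

Lemma net_content_has_lbound E :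
  has_lbound [set B | exists W, cell_cover W E /\ cost_le W B].
Proof.
exists 0 => B [W [_ /(_ [::] isT)]]; rewrite /cost big_nil; exact.
Qed.

Lemma net_content_le W E B : cell_cover W E -> cost_le W B -> net_content E <= B.
Proof.
by move=> cW cB; apply: (ge_inf (net_content_has_lbound E)); exists W.
Qed.

(** As [E] lies in a single cell of level 0, of cost 1, the infimum runs over a nonempty set and is
    therefore approached. *)
Lemma net_content_cover E e : (forall x y, E x -> E y -> q 0 x = q 0 y) -> 0 < e ->
  exists W, cell_cover W E /\ cost_le W (net_content E + e).
Proof.
move=> E0 e0.
have ne : [set B | exists W, cell_cover W E /\ cost_le W B] !=set0.
  exists 1, [set a | a.1 = 0%N /\ exists2 x, E x & q 0 x = a.2]; split.
    by move=> x Ex; exists 0%N; split => //; exists x.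
  move=> [|a [|b l]] ul lW; first by rewrite /cost big_nil.
    rewrite /cost big_seq1.
    have [-> _] : a.1 = 0%N /\ exists2 x, E x & q 0 x = a.2.
      by apply: lW; rewrite mem_head.
    by rewrite expr0.
  move: ul => /= /andP[+ _]; rewrite inE negb_or => /andP[+ _].
  have [a1 [x Ex xa]] := lW a (mem_head _ _).
  have [b1 [y Ey yb]] : [set a | a.1 = 0%N /\ exists2 x, E x & q 0 x = a.2] b.
    by apply: lW; rewrite !inE eqxx orbT.
  case: a b a1 b1 xa yb {lW} => [a1 a2] [b1 b2] /= -> -> <- <-.
  by rewrite (E0 _ _ Ex Ey) eqxx.
have [B [W [cW cB]] lB] := inf_adherent e0 (conj ne (net_content_has_lbound E)).
by exists W; split => //; apply: cost_le_trans cB; apply: ltW.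
Qed.

(* Strong subadditivity: the cells discarded from [V `|` W] by [coarsest],
   together with [V `&` W], still cover [F]. *)
Lemma coarsest_cost V W F a b : cell_cover V F -> cell_cover W F ->
  cost_le V a -> cost_le W b ->
  cost_le (coarsest (V `|` W)) (a + b - net_content F).
Proof.
move=> cV cW ca cb l ul lM.
pose Z := (V `&` W) `|` ((V `|` W) `\` coarsest (V `|` W)).
have cZ : cell_cover Z F.
  move=> x Fx; have [j Vj] := cV x Fx; have [k Wk] := cW x Fx.
  have [jk|kj|jk] := ltngtP j k.
  - exists k; right; split; first by right.
    by move=> [_ /(_ j x jk erefl)]; apply; left.
  - exists j; right; split; first by left.
    by move=> [_ /(_ k x kj erefl)]; apply; right.
  - by exists j; left; split => //; rewrite jk.
rewrite lerBrDl -lerBrDr; apply: (net_content_le cZ) => l' ul' lZ.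
rewrite lerBrDr.
pose L := undup (l ++ l'); pose w (a : nat * C) := rho ^+ a.1.
have w0 c : 0 <= w c by rewrite /w exprn_ge0.
have uL : uniq L by apply: undup_uniq.
have sumL (s : seq (nat * C)) : uniq s -> {subset s <= L} ->
    cost s = \sum_(c <- L) (c \in s)%:R * w c.
  move=> us sL; rewrite /cost [RHS](bigID (fun c => c \in s)) /=.
  rewrite [X in _ + X]big1 ?addr0; last first.
    by move=> c /negbTE ->; rewrite mul0r.
  under [RHS]eq_bigr => c -> do rewrite mul1r.
  rewrite -[RHS]big_filter; apply: perm_big; apply: uniq_perm => //.
    exact: filter_uniq.
  by move=> c; rewrite mem_filter; case: (boolP (c \in s)) => // /sL ->.
rewrite [X in X + _]sumL //; last by move=> c cl; rewrite mem_undup mem_cat cl orbT.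
rewrite [X in _ + X]sumL //; last by move=> c cl; rewrite mem_undup mem_cat cl.
have := lerD (ca [seq c <- L | `[< V c >]] (filter_uniq _ uL) _)
             (cb [seq c <- L | `[< W c >]] (filter_uniq _ uL) _).
have fP (Q : set (nat * C)) c : c \in [seq c <- L | `[< Q c >]] -> Q c.
  by rewrite mem_filter => /andP[/asboolP].
move=> /(_ (fP V) (fP W)); apply: le_trans.
rewrite !sumL ?filter_uniq //; try by move=> c; rewrite mem_filter => /andP[].
rewrite -!big_split /=; rewrite [leLHS]big_seq [leRHS]big_seq; apply: ler_sum => c cL.
rewrite -!mulrDl ler_wpM2r // -!natrD ler_nat !mem_filter cL !andbT.
case: (boolP (c \in l)) => [/lM lMc|_]; case: (boolP (c \in l')) => [/lZ lZc|_] //=.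
- by case: lZc => [[Vc Wc]|[_ []//]]; rewrite !asboolT.
- by case: lMc => -[H|H] _; rewrite (asboolT H) ?addn1 ?leq_addl ?leq_addr.
- case: lZc => [[Vc Wc]|[[H|H] _]]; rewrite ?(asboolT Vc) ?(asboolT H) ?leq_addr //.
  by rewrite leq_addl.
Qed.

(** Continuity along increasing unions, the property behind capacitability. Near-optimal covers of
    the [E n] are merged one at a time; by [coarsest_cost] each merger adds to the cost only the
    growth of the content and a geometric error. *)
Lemma net_content_increasing (E : nat -> set X) (c : R) :
  (forall n, E n `<=` E n.+1) ->
  (forall x y, (\bigcup_n E n) x -> (\bigcup_n E n) y -> q 0 x = q 0 y) ->
  (forall n, net_content (E n) <= c) -> net_content (\bigcup_n E n) <= c.
Proof.
move=> Einc E0 Ec; apply/ler_addgt0Pr => e e0.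
have exW n : exists W, cell_cover W (E n) /\
    cost_le W (net_content (E n) + e / 2 ^+ n.+1).
  apply: net_content_cover; last by rewrite divr_gt0 ?exprn_gt0.
  by move=> x y Ex Ey; apply: E0; exists n.
have [W /all_and2[cW bW]] := choice exW.
pose V n := coarsest (\bigcup_(m in [set m | (m <= n)%N]) W m).
have cV n : cell_cover (V n) (E n).
  apply: cell_cover_coarsest => x Ex; have [k Wk] := cW n x Ex.
  by exists k, n => /=.
have bV n : cost_le (V n) (net_content (E n) + e * (1 - (2 ^+ n.+1)^-1)).
  elim: n => [|n IH].
    apply: cost_le_sub (cost_le_trans _ (bW 0%N)) => [a [[m /= m0] Wm _]|].
      by move: Wm; have -> : m = 0%N by lia.
    by rewrite lerD2l expr1 ler_pM2l // ; lra.
  (* The old cover and the new one both cover [E n], so its content cancels against the bound on the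
     old cover. *)
  have := coarsest_cost (cV n) _ IH (bW n.+1).
  have cWn : cell_cover (W n.+1) (E n) by move=> x /Einc; apply: cW.
  move=> /(_ cWn) H; apply: cost_le_sub (cost_le_trans _ H).
    move=> a [[m /= mn Wm] Ha]; split.
      move: mn; rewrite leq_eqVlt => /orP[/eqP mn|mn]; first by right; rewrite -mn.
      left; split; first by exists m => /=.
      move=> j x ja xa [m' /= mn' Wm']; apply: (Ha j x ja xa).
      by exists m' => //=; apply: leqW.
    move=> j x ja xa [[[m' /= mn' Wm'] _]|Wn]; apply: (Ha j x ja xa).
      by exists m' => //=; apply: leqW.
    by exists n.+1 => /=.
  rewrite le_eqVlt; apply/orP; left; apply/eqP.
  rewrite [in 2 ^+ n.+2]exprS; have : (2 : R) ^+ n.+1 != 0 by rewrite expf_neq0.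
  by move=> ?; field.
apply: (@net_content_le (coarsest (\bigcup_m W m))).
  by apply: cell_cover_coarsest => x [n _ /cW[k Wk]]; exists k, n.
move=> l ul lM.
(* A finite list of cells involves finitely many [W m] only, hence lies in some [V N]. *)
have [N lN] : exists N, forall a, a \in l -> (\bigcup_(m in [set m | (m <= N)%N]) W m) a.
  elim: l lM {ul} => [|a l IH] lM; first by exists 0%N.
  have [|N HN] := IH; first by move=> b bl; apply: lM; rewrite inE bl orbT.
  have [[m _ Wm] _] := lM a (mem_head _ _).
  exists (maxn m N) => b; rewrite inE => /orP[/eqP ->|/HN [m' /= m'N Wm']].
    by exists m => //=; rewrite leq_maxl.
  by exists m' => //=; rewrite (leq_trans m'N) ?leq_maxr.
apply: le_trans (bV N l ul _) _.
  move=> a al; split; first exact: lN.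
  have [_ Ha] := lM a al; move=> j x ja xa [m _ Wm].
  by apply: (Ha j x ja xa); exists m.
rewrite lerD // -[leRHS]mulr1 ler_pM2l // gerBl invr_ge0 exprn_ge0 //.
Qed.

End NetContent.

(** * Frostman weights at a finite scale *)

Section FiniteFrostman.
Context (R : realType) (X C : eqType) (q : nat -> X -> C) (rho : R).
Hypothesis rho_gt0 : 0 < rho.
Hypothesis q_nested : forall k x y, q k.+1 x = q k.+1 y -> q k x = q k y.

Lemma cell_representatives L (s : seq X) : exists s' : seq X,
  [/\ {subset s' <= s}, uniq (map (q L) s') &
      forall x, x \in s -> q L x \in map (q L) s'].
Proof.
elim: s => [|x s [s' [ss us cs]]]; first by exists [::].
have [xs|xs] := boolP (q L x \in map (q L) s').
  exists s'; split => // [y /ss ys|y]; first by rewrite inE ys orbT.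
  by rewrite inE => /orP[/eqP ->|/cs].
exists (x :: s'); split => /=; last 1 first.
- move=> y; rewrite inE => /orP[/eqP ->|/cs ys]; first exact: mem_head.
  by rewrite inE ys orbT.
- by move=> y; rewrite !inE => /orP[->//|/ss ->]; rewrite orbT.
- by rewrite xs.
Qed.

Let cell_mass (P : seq X) (w : X -> R) k c := \sum_(p <- P | q k p == c) w p.

(* Where a cell of level [j] is overloaded, its weights are scaled down until it
   is saturated, so every point stays in some saturated cell. *)
Lemma truncate_weights (E : set X) (P : seq X) (w : X -> R) (j L : nat) :
  (forall x, 0 <= w x) ->
  (forall k c, (j < k <= L)%N -> cell_mass P w k c <= rho ^+ k) ->
  (forall x, E x -> exists2 k, (j < k <= L)%N & cell_mass P w k (q k x) = rho ^+ k) ->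
  exists w' : X -> R, [/\ forall x, 0 <= w' x,
   forall k c, (j <= k <= L)%N -> cell_mass P w' k c <= rho ^+ k &
   forall x, E x -> exists2 k, (j <= k <= L)%N & cell_mass P w' k (q k x) = rho ^+ k].
Proof.
move=> w0 wk wE.
pose S c := cell_mass P w j c.
pose f c := if S c <= rho ^+ j then 1 else rho ^+ j / S c.
have rj : 0 < rho ^+ j by rewrite exprn_gt0.
have f0 c : 0 <= f c.
  rewrite /f; case: (leP (S c) (rho ^+ j)) => // rS.
  by rewrite divr_ge0 ?(ltW rj) // ltW // (lt_trans rj).
have f1 c : f c <= 1.
  rewrite /f; case: (leP (S c) (rho ^+ j)) => // rS.
  by rewrite ler_pdivrMr ?mul1r ?(ltW rS) // (lt_trans rj).
pose w' x := w x * f (q j x).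
have massE k x : (j <= k)%N -> cell_mass P w' k (q k x) = cell_mass P w k (q k x) * f (q j x).
  move=> jk; rewrite /cell_mass mulr_suml; apply: eq_bigr => p /eqP pk.
  by rewrite /w' (q_nested_le q_nested jk pk).
have mass0 k c : (forall p, p \in P -> q k p != c) -> cell_mass P w' k c = 0.
  move=> Pc; rewrite /cell_mass big_seq_cond big1 // => p /andP[pP pc].
  by have := Pc p pP; rewrite pc.
have fS c : f c * S c <= rho ^+ j.
  rewrite /f; case: (leP (S c) (rho ^+ j)) => [|rS]; first by rewrite mul1r.
  by rewrite divfK // gt_eqF // (lt_trans rj).
exists w'; split.
- by move=> x; rewrite mulr_ge0.
- move=> k c /andP[jk kL].
  have [/hasP[p pP /eqP <-]|/hasPn Pc] := boolP (has (fun p => q k p == c) P); last first.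
    by rewrite mass0 // exprn_ge0 // ltW.
  rewrite massE //; move: jk; rewrite leq_eqVlt => /orP[/eqP <-|jk].
    by rewrite mulrC fS.
  apply: le_trans (wk k (q k p) _); last by rewrite jk.
  by rewrite ler_piMr // sumr_ge0.
- move=> x Ex; have [Sx|Sx] := leP (S (q j x)) (rho ^+ j).
    have [k /andP[jk kL] kx] := wE x Ex; exists k; first by rewrite (ltnW jk).
    by rewrite massE ?(ltnW jk) // kx /f Sx mulr1.
  have [k /andP[jk kL] _] := wE x Ex.
  exists j; first by rewrite leqnn ltnW // (leq_trans jk).
  by rewrite massE // /f leNgt Sx /= mulrC divfK // gt_eqF // (lt_trans rj).
Qed.

(** Start with weight [rho ^+ L] at one point per cell of level [L] and truncate level by level up
    to level 0. Then every point of [E] lies in a saturated cell. The maximal saturated cells are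
    disjoint and cover [E], so the total weight dominates their cost, hence the content. *)
Lemma finite_frostman (E : set X) (c : R) (L : nat) (P0 : seq X) :
  (forall p, p \in P0 -> E p) ->
  (forall x, E x -> exists2 p, p \in P0 & q L x = q L p) ->
  c <= net_content q rho E ->
  exists (P : seq X) (w : X -> R), [/\ forall p, p \in P -> E p, forall x, 0 <= w x,
    c <= \sum_(p <- P) w p &
    forall k a, (k <= L)%N -> \sum_(p <- P | q k p == a) w p <= rho ^+ k].
Proof.
move=> P0E EP0 cE; have [P [PP0 uP cP]] := cell_representatives L P0.
have scales n : (n <= L)%N -> exists w' : X -> R, [/\ forall x, 0 <= w' x,
   forall k c, (L - n <= k <= L)%N -> cell_mass P w' k c <= rho ^+ k &
   forall x, E x -> exists2 k, (L - n <= k <= L)%N & cell_mass P w' k (q k x) = rho ^+ k].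
  elim: n => [_|n IH nL]; last first.
    have [w [w0 wk wE]] := IH (ltnW nL).
    apply: (truncate_weights w0) => [k d|x /wE [k]].
      by rewrite -subSn // subSS; apply: wk.
    by rewrite -subSn // subSS => kk Hk; exists k.
  rewrite subn0; exists (fun _ => rho ^+ L).
  have mass a : cell_mass P (fun=> rho ^+ L) L a = rho ^+ L * (a \in map (q L) P)%:R.
    rewrite /cell_mass big_const_seq iter_addr_0 mulr_natr; congr (_ *+ _).
    by rewrite -[count _ _](count_map _ (pred1 a)) count_uniq_mem.
  split=> [x|k a|x Ex]; first by rewrite exprn_ge0 // ltW.
    rewrite -eqn_leq => /eqP <-; rewrite mass ler_piMr //; first by rewrite exprn_ge0 // ltW.
    by rewrite lern1 leq_b1.
  exists L; first by rewrite leqnn.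
  have [p pP ->] := EP0 x Ex.
  by rewrite mass cP // mulr1.
have [w [w0 wk wE]] := scales L (leqnn L).
exists P, w; split=> //; first by move=> p /PP0 /P0E.
  apply: le_trans cE _.
  pose W := coarsest q [set a | (a.1 <= L)%N /\ cell_mass P w a.1 a.2 = rho ^+ a.1].
  apply: (@net_content_le _ _ _ q rho W).
    apply: cell_cover_coarsest => // x /wE[k /andP[_ kL] xk].
    by exists k.
  move=> l ul lW.
  have -> : cost rho l = \sum_(p <- P) w p * (count (fun a => q a.1 p == a.2) l)%:R.
    rewrite /cost big_seq.
    under eq_bigr => a al do (have [[_ <-] _] := lW a al; rewrite /cell_mass big_mkcond /=).
    rewrite -big_seq exchange_big /=; apply: eq_bigr => p _.
    rewrite -big_mkcond big_const_seq iter_addr_0 mulr_natr; congr (_ *+ _).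
  (* A point lies in at most one maximal cell, so its weight is counted at most once. *)
  apply: ler_sum => p _; rewrite ler_piMr // lern1.
  rewrite -size_filter; case E1 : [seq _ <- _ | _] => [//|a [//|b l']].
  have : uniq [:: a, b & l'] by rewrite -E1 filter_uniq.
  rewrite /= inE negb_or => /andP[/andP[ab _] _].
  have : b \in [:: a, b & l'] by rewrite !inE eqxx orbT.
  have : a \in [:: a, b & l'] by rewrite mem_head.
  rewrite -E1 !mem_filter => /andP[/eqP pa /lW [Wa na]] /andP[/eqP pb /lW [Wb nb]].
  have [lt|lt|eq] := ltngtP a.1 b.1.
  - exfalso; apply: (nb _ p lt pb); case: a Wa pa {na E1 ab lt} => a1 a2 /= + ->; exact.
  - exfalso; apply: (na _ p lt pa); case: b Wb pb {nb E1 ab lt} => a1 a2 /= + ->; exact.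
  - move: ab; case: a b eq pa pb {Wa Wb na nb E1} => [a1 a2] [b1 b2] /= -> -> ->.
    by rewrite eqxx.
by move=> k a kL; apply: wk; rewrite subnn.
Qed.

End FiniteFrostman.

(** * Analytic sets and capacitability *)

Section Analytic.
Context {X : topologicalType}.

(* A set is analytic when it is the projection of a closed subset of
   [X * (nat -> nat)]; closedness is tested along filters on [nat], the second
   factor carrying the product of discrete topologies. *)
Definition filter_closed (T : X -> (nat -> nat) -> Prop) :=
  forall (F : set_system nat), ProperFilter F -> forall (y : nat -> X) a x b,
    y @ F --> x -> (forall i, F [set n | a n i = b i]) ->
    F [set n | T (y n) (a n)] -> T x b.

Definition analytic (E : set X) :=
  exists T, filter_closed T /\ E = [set x | exists a, T x a].

Lemma analytic_closed E : closed E -> analytic E.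
Proof.
move=> clE; exists (fun x _ => E x); split; last first.
  by apply/seteqP; split => [x Ex|x [_ //]]; exists (fun=> 0%N).
by move=> F FF y a x b yx _ FE; exact: (@closed_cvg _ _ F FF y E clE FE x yx).
Qed.

(** The first entry of the witness selects the set, the remaining ones form a witness for that
    set. *)
Lemma analytic_bigcup (E : nat -> set X) :
  (forall n, analytic (E n)) -> analytic (\bigcup_n E n).
Proof.
move=> /choice[T /all_and2[clT ET]].
exists (fun x a => T (a 0%N) x (fun i => a i.+1)); split; last first.
  apply/seteqP; split => [x [n _]|x [a Ta]]; last first.
    by exists (a 0%N) => //; rewrite ET; exists (fun i => a i.+1).
  rewrite ET => -[a Ta]; exists (fun i => if i is j.+1 then a j else n).
  exact: Ta.
move=> F FF y a x b yx ab FT.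
apply: (clT (b 0%N) F FF y (fun n i => a n i.+1) x) => //.
by apply: filterS2 FT (ab 0%N) => n /= + <-.
Qed.

(** A single sequence codes witnesses for all the sets at once, pairs of indices being coded by
    [pickle]. *)
Lemma analytic_bigcap (E : nat -> set X) :
  (forall n, analytic (E n)) -> analytic (\bigcap_n E n).
Proof.
move=> /choice[T /all_and2[clT ET]].
exists (fun x a => forall m, T m x (fun i => a (pickle (m, i)))); split.
  move=> F FF y a x b yx ab FT m.
  apply: (clT m F FF y (fun n i => a n (pickle (m, i))) x) => //.
  by apply: filterS FT => n /=; apply.
apply/seteqP; split => [x Ex|x [a Ta] m _]; last first.
  by rewrite ET; eexists; apply: Ta.
have /choice[a aT] : forall m, exists a, T m x a.
  by move=> m; have := Ex m I; rewrite ET.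
exists (fun k => if unpickle k is Some (m, i) then a m i else 0%N) => m.
by under eq_fun => i do rewrite pickleK; apply: aT.
Qed.

Lemma analytic_setI (A B : set X) : analytic A -> analytic B -> analytic (A `&` B).
Proof.
move=> aA aB; have : analytic (\bigcap_n (if n is 0%N then A else B)).
  by apply: analytic_bigcap => -[].
congr analytic; apply/seteqP; split=> [x Hx|x [Ax Bx] [|n] _ //].
by split; [exact: (Hx 0%N)|exact: (Hx 1%N)].
Qed.

End Analytic.

Section Borel.
Context {R : realType} {X : pseudoMetricType R}.

(** An open set is a countable union of closed ones: a point of [D n] is within 1/(n+1) of a point
    whose ball of that radius lies in [U]. *)
Lemma analytic_open (U : set X) : open U -> analytic U.
Proof.
move=> oU; pose D n := closure [set x | ball x n.+1%:R^-1 `<=` U].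
have -> : U = \bigcup_n D n.
  apply/seteqP; split => [x|x [n _ /(_ (ball x n.+1%:R^-1))]]; last first.
    have n0 : 0 < n.+1%:R^-1 :> R by rewrite invr_gt0.
    by move=> /(_ (nbhsx_ballx _ _ n0))[y [yU /ball_sym]]; apply: yU.
  move: oU; rewrite openE => /[apply].
  rewrite /interior -nbhs_ballE => -[e /= e0 eU].
  have [n _ /(_ n (leqnn n)) /= ne] := near_infty_natSinv_lt (PosNum e0).
  exists n => //; apply: subset_closure => y /(le_ball (ltW ne)); exact: eU.
by apply: analytic_bigcup => n; apply: analytic_closed; apply: closed_closure.
Qed.

(** The analytic sets with analytic complement form a sigma-algebra containing the open sets. *)
Lemma analytic_borel (E : set X) : borel_set E -> analytic E.
Proof.
move=> bE; have [] : (analytic E /\ analytic (~` E)); last by [].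
apply: (bE [set A | analytic A /\ analytic (~` A)]); split; last first.
  move=> U oU; split; first exact: analytic_open.
  by apply: analytic_closed; apply: open_closedC.
split.
- split; first by apply: analytic_closed; exact: closed0.
  by apply: analytic_closed; rewrite setC0; exact: closedT.
- by move=> A [aA aC] /=; rewrite setTD setCK.
- move=> A /all_and2[aA aC]; split; first exact: analytic_bigcup.
  by rewrite setC_bigcup; apply: analytic_bigcap.
Qed.

End Borel.

(** Used entry by entry, this provides a limit for witnesses whose entries are bounded. *)
Lemma ultra_bounded_nat (F : set_system nat) (FF : UltraFilter F) (a : nat -> nat) N :
  F [set n | (a n <= N)%N] -> exists b, F [set n | a n = b].
Proof.
elim: N => [FN|N IH FN].
  by exists 0%N; apply: filterS FN => n /=; rewrite leqn0 => /eqP.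
have [Fb|Fb] := in_ultra_setVsetC [set n | a n = N.+1] FF; first by exists N.+1.
by apply: IH; apply: filterS2 FN Fb => n /=; lia.
Qed.

Section Capacitability.
Context (R : realType) (X : topologicalType) (C : eqType) (q : nat -> X -> C) (rho : R).
Hypothesis rho_ge0 : 0 <= rho.
Hypothesis q_nested : forall k x y, q k.+1 x = q k.+1 y -> q k x = q k y.

(* The last clause says that the limit points of the sequence [K] lie in [E]: it
   stands for the compactness of the intersection of the closures. *)
Lemma capacitability (E : set X) (c : R) : analytic E ->
  (forall x y, E x -> E y -> q 0 x = q 0 y) -> c < net_content q rho E ->
  exists K : nat -> set X, [/\ forall n, K n.+1 `<=` K n, forall n, K n `<=` E,
    forall n, c < net_content q rho (K n) &
    forall F : set_system nat, UltraFilter F -> (forall m, F [set n | (m <= n)%N]) ->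
    forall y x, (forall n, K n (y n)) -> y @ F --> x -> E x].
Proof.
move=> [T [clT ET]] E0 cE.
pose Es l := [set x | exists a, T x a /\ forall i, (i < size l)%N -> (a i <= nth 0 l i)%N].
have EsE l : Es l `<=` E by move=> x [a [Ta _]]; rewrite ET; exists a.
(* Bounding one more entry by [N] exhausts [Es l] by an increasing union, so by continuity of the
   content some [N] keeps it above [c]. *)
have step l : exists N, c < net_content q rho (Es l) -> c < net_content q rho (Es (rcons l N)).
  have [H|/forallNP H] := pselect (exists N, c < net_content q rho (Es (rcons l N))).
    by case: H => N HN; exists N.
  exists 0%N => cl; exfalso; move: cl; apply/negP; rewrite -leNgt.
  have -> : Es l = \bigcup_N Es (rcons l N).
    apply/seteqP; split => [x [a [Ta al]]|x [N _ [a [Ta al]]]].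
      exists (a (size l)) => //; exists a; split=> // i; rewrite size_rcons ltnS nth_rcons.
      by rewrite leq_eqVlt => /orP[/eqP ->|il]; rewrite ?ltnn ?eqxx // il al.
    exists a; split=> // i il; have := al i; rewrite size_rcons nth_rcons il.
    by apply; apply: leqW.
  apply: net_content_increasing => // [N x [a [Ta al]]|x y [N _ /EsE xE] [M _ /EsE yE]|N].
  - exists a; split => // i il; apply: leq_trans (al i _) _.
      by move: il; rewrite !size_rcons.
    by rewrite !nth_rcons; case: ifP => // _; case: ifP.
  - exact: E0.
  - by rewrite leNgt; apply/negP; apply: H.
have [g gP] := choice step.
pose l k := iter k (fun l => rcons l (g l)) [::].
have sl k : size (l k) = k by elim: k => //= k IH; rewrite size_rcons IH.
have ll i k : (i < k)%N -> nth 0%N (l k) i = nth 0%N (l i.+1) i.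
  elim: k => // k IH; rewrite ltnS leq_eqVlt => /orP[/eqP -> //|ik].
  by rewrite -IH //= nth_rcons sl ik.
exists (fun k => Es (l k)); split=> //.
- move=> n x [a [Ta al]]; exists a; split => // i.
  rewrite sl => il; have := al i; rewrite !sl !ll //; first by apply; apply: leqW.
  exact: leqW.
- elim=> [|n IH]; last exact: gP.
  suff -> : Es (l 0%N) = E by [].
  by apply/seteqP; split => x; [exact: EsE|rewrite {1}ET => -[a Ta]; exists a].
- move=> F FF Fn y x yK yx; have [a /all_and2[Ta al]] := choice yK.
  (* Entry [i] of the witnesses is bounded for [n] > [i], hence constant along the ultrafilter;
     closedness of [T] then puts the limit point in [E]. *)
  have /choice[b bP] i : exists b, F [set n | a n i = b].
    apply: (ultra_bounded_nat FF (N := nth 0%N (l i.+1) i)).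
    apply: filterS (Fn i.+1) => n /= ni; rewrite -(ll i n) //.
    by apply: al; rewrite sl.
  rewrite ET; exists b; apply: (clT F _ y a x) => //.
  by apply: filterS (Fn 0%N) => n _; apply: Ta.
Qed.

End Capacitability.

(** * Null sets of the plane *)

Section Plane.
Context {R : realType}.
Implicit Types (a x y : 'rV[R]_2) (E : set 'rV[R]_2).

Lemma ord2P (P : 'I_2 -> Prop) : P 0 -> P 1 -> forall i, P i.
Proof.
move=> P0 P1 [[|[|//]] i2].
  by have -> : Ordinal i2 = 0 by apply: val_inj.
by have -> : Ordinal i2 = 1 by apply: val_inj.
Qed.

Lemma ball_coordP a r x : ball a r x <->
  [/\ 0 < r, `|a 0 0 - x 0 0| < r & `|a 0 1 - x 0 1| < r].
Proof.
split => [[r0 H]|[r0 H0 H1]]; first by split => //; apply: H.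
split=> // i; rewrite !ord1; exact: ord2P.
Qed.

Lemma eucl_normE x : eucl_norm x = Num.sqrt (x 0 0 ^+ 2 + x 0 1 ^+ 2).
Proof.
rewrite /eucl_norm !big_ord_recl big_ord0 addr0.
by have -> : lift ord0 ord0 = 1 :> 'I_2 by apply: val_inj.
Qed.

Lemma eucl_norm_ge0 x : 0 <= eucl_norm x.
Proof. by rewrite eucl_normE sqrtr_ge0. Qed.

Lemma sqr_eucl_norm x : eucl_norm x ^+ 2 = x 0 0 ^+ 2 + x 0 1 ^+ 2.
Proof. by rewrite eucl_normE sqr_sqrtr // addr_ge0 // sqr_ge0. Qed.

Lemma coord_le_eucl_norm x i : `|x 0 i| <= eucl_norm x.
Proof.
rewrite -(ler_pXn2r (n := 2)) ?nnegrE ?eucl_norm_ge0 // sqr_eucl_norm real_normK ?num_real //.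
by move: i; apply: ord2P; rewrite ?lerDl ?lerDr sqr_ge0.
Qed.

Lemma eucl_norm_le x r : `|x 0 0| <= r -> `|x 0 1| <= r -> eucl_norm x <= 2 * r.
Proof.
move=> x0 x1; have r0 : 0 <= r by apply: le_trans x0.
rewrite -(ler_pXn2r (n := 2)) ?nnegrE ?eucl_norm_ge0 ?mulr_ge0 // sqr_eucl_norm.
have : x 0 0 ^+ 2 <= r ^+ 2 by rewrite -(real_normK (num_real _)) lerXn2r ?nnegrE.
have : x 0 1 ^+ 2 <= r ^+ 2 by rewrite -(real_normK (num_real _)) lerXn2r ?nnegrE.
rewrite exprMn; have := sqr_ge0 r; lra.
Qed.

(* Radii are positive, so that covers consist of open balls; [t] is meant to be
   positive, and then this says that the [t]-dimensional Hausdorff measure is 0. *)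
Definition null_dim (t : R) E := forall e, 0 < e ->
  exists (a : nat -> 'rV[R]_2) (r : nat -> R), [/\ forall k, 0 < r k,
    E `<=` \bigcup_k ball (a k) (r k) &
    forall N, \sum_(k < N) r k `^ t <= e].

Definition geom_radius (t e : R) (k : nat) : R := (e / 2 ^+ k.+1) `^ (t^-1).

Lemma geom_radius_gt0 t e k : 0 < e -> 0 < geom_radius t e k.
Proof. by move=> e0; rewrite powR_gt0 // divr_gt0 // exprn_gt0. Qed.

Lemma geom_radius_powR t e k : 0 < t -> 0 < e ->
  geom_radius t e k `^ t = e / 2 ^+ k.+1.
Proof.
move=> t0 e0; rewrite /geom_radius -powRrM mulVf ?gt_eqF // powRr1 //.
by rewrite divr_ge0 ?ltW // exprn_gt0.
Qed.

Lemma sum_geom (e : R) N : 0 < e -> \sum_(k < N) e / 2 ^+ k.+1 <= e.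
Proof.
move=> e0; suff -> : \sum_(k < N) e / 2 ^+ k.+1 = e - e / 2 ^+ N.
  by rewrite gerBl divr_ge0 ?ltW // exprn_gt0.
elim: N => [|N IH]; first by rewrite big_ord0 expr0 divr1 subrr.
rewrite big_ord_recr /= IH exprS; have : (2 : R) ^+ N != 0 by rewrite expf_neq0.
by move=> ?; field.
Qed.

Lemma null_dim_sub t E F : E `<=` F -> null_dim t F -> null_dim t E.
Proof.
move=> EF nF e /nF[a [r [r0 Far rt]]]; exists a, r; split => //.
exact: subset_trans Far.
Qed.

(** A cover indexed by part of a countable type becomes a sequence through [pickle]; the other
    indices receive the radii [geom_radius], at a total cost of at most [e / 2]. *)
Lemma null_dim_countable (I : countType) (t : R) E : 0 < t ->
  (forall e, 0 < e -> exists (W : set I) (a : I -> 'rV[R]_2) (r : I -> R),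
     [/\ forall i, W i -> 0 < r i, E `<=` \bigcup_(i in W) ball (a i) (r i) &
       forall l, uniq l -> (forall i, i \in l -> W i) -> \sum_(i <- l) r i `^ t <= e]) ->
  null_dim t E.
Proof.
move=> t0 H e e0; have e20 : 0 < e / 2 by rewrite divr_gt0.
have [W [a [r [r0 Ear rt]]]] := H _ e20.
pose u := @pickle_inv I.
pose b k := if u k is Some i then a i else 0.
pose g := geom_radius t (e / 2).
pose s k := if u k is Some i then (if `[< W i >] then r i else g k) else g k.
exists b, s; split.
- move=> k; rewrite /s; case: (u k) => [i|]; last exact: geom_radius_gt0.
  by case: asboolP => [/r0|_] //; apply: geom_radius_gt0.
- move=> x /Ear[i Wi xi]; exists (pickle i) => //.
  by rewrite /b /s /u pickleK_inv asboolT.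
move=> N; pose l := [seq i <- pmap u (iota 0 N) | `[< W i >]].
have lW i : i \in l -> W i by rewrite mem_filter => /andP[/asboolP].
have ul : uniq l by rewrite filter_uniq // (pmap_uniq (@pickle_invK I)) // iota_uniq.
pose h k := if u k is Some i then (if `[< W i >] then r i `^ t else 0) else 0.
have hl : \sum_(k < N) h k = \sum_(i <- l) r i `^ t.
  rewrite -(big_mkord xpredT h) /index_iota subn0 /l.
  elim: (iota 0 N) => [|k n IH]; first by rewrite !big_nil.
  rewrite big_cons IH /h /=; case: (u k) => [i|] /=; last by rewrite add0r.
  by case: asboolP => Wi; rewrite ?add0r // big_cons.
have : \sum_(k < N) s k `^ t <= \sum_(k < N) (h k + (e / 2) / 2 ^+ k.+1).
  apply: ler_sum => k _; rewrite -(geom_radius_powR k t0 e20) /s /h.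
  by case: (u k) => [i|]; [case: ifP => _|]; rewrite ?add0r // lerDl powR_ge0.
rewrite big_split /= hl => /le_trans; apply.
by rewrite [leRHS](splitr e) lerD ?rt // sum_geom.
Qed.

Lemma null_dim_bigcup t (E : nat -> set 'rV[R]_2) : 0 < t ->
  (forall n, null_dim t (E n)) -> null_dim t (\bigcup_n E n).
Proof.
move=> t0 nE; apply: (@null_dim_countable (nat * nat)%type) => // e e0.
have e2 n : 0 < e / 2 ^+ n.+1 by rewrite divr_gt0 // exprn_gt0.
have /choice[a /choice[r H]] n := nE n _ (e2 n).
have [r0 Ear rt] := all_and3 H.
exists setT, (fun p => a p.1 p.2), (fun p => r p.1 p.2); split => //.
- by move=> x [n _ /Ear[k _ xk]]; exists (n, k).
move=> l ul _.
pose M := \max_(p <- l) (maxn p.1 p.2).+1.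
pose L := [seq (n, k) | n <- iota 0 M, k <- iota 0 M].
have lL : {subset l <= L}.
  move=> [n k] nkl; have : (maxn n k < M)%N.
    by rewrite /M (big_rem _ nkl) /= leq_maxl.
  rewrite gtn_max => /andP[nM kM].
  by apply/allpairsP; exists (n, k); rewrite !mem_iota.
have uL : uniq L by apply: allpairs_uniq; rewrite ?iota_uniq // => -[? ?] [].
have : \sum_(p <- l) r p.1 p.2 `^ t <= \sum_(p <- L) r p.1 p.2 `^ t.
  have -> : \sum_(p <- l) r p.1 p.2 `^ t = \sum_(p <- L | p \in l) r p.1 p.2 `^ t.
    rewrite -[RHS]big_filter; apply: perm_big; apply: uniq_perm => //.
      exact: filter_uniq.
    by move=> p; rewrite mem_filter; case: (boolP (p \in l)) => // /lL ->.
  rewrite big_mkcond /=; apply: ler_sum => p _; case: ifP => // _.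
  exact: powR_ge0.
move=> /le_trans; apply; rewrite big_allpairs.
apply: le_trans (sum_geom M e0).
rewrite -[leRHS](big_mkord xpredT (fun k => e / 2 ^+ k.+1)) /index_iota subn0.
apply: ler_sum => n _; apply: le_trans (rt n M).
by rewrite -[leRHS](big_mkord xpredT (fun k => r n k `^ t)) /index_iota subn0.
Qed.

End Plane.

Section HausdorffNull.
Context {R : realType}.
Implicit Types (a x y : 'rV[R]_2) (E : set 'rV[R]_2).

Lemma diameter_ge0 E : (0 <= diameter E)%E.
Proof. by apply: ereal_sup_ubound; left. Qed.

Lemma eucl_norm_le_diameter E x y : E x -> E y ->
  ((eucl_norm (x - y))%:E <= diameter E)%E.
Proof. by move=> Ex Ey; apply: ereal_sup_ubound; right; exists (x, y). Qed.

Lemma diameter_pow_ge0 s E : (0 <= diameter_pow s E)%E.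
Proof. by rewrite /diameter_pow; case: ifP => // _; exact: poweR_ge0. Qed.

(** The premeasure at scale 1 suffices: for diameters at most 1 the [t]-th power is below the
    [t0]-th. As [t] is positive, sets of diameter 0 can be replaced by balls of small cost. *)
Lemma null_dim_hausdorff t0 t E : 0 <= t0 -> t0 < t ->
  hausdorff_measure t0 E = 0%E -> null_dim t E.
Proof.
move=> t00 t0t H0 e e0; have t_gt0 := le_lt_trans t00 t0t.
pose e' := e / 2 / 2 `^ t.
have p2 : 0 < 2 `^ t :> R by rewrite powR_gt0.
have e'0 : 0 < e' by rewrite !divr_gt0.
have : (hausdorff_premeasure t0 1 E < e'%:E)%E.
  apply: (@le_lt_trans _ _ 0%E); last by rewrite lte_fin.
  by rewrite -H0; apply: ereal_sup_ubound; exists 1 => //=.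
move=> /ereal_inf_lt[_ [U [EU U1] <-] Ue].
pose d k := fine (diameter (U k)).
have dE k : diameter (U k) = (d k)%:E.
  rewrite fineK // ge0_fin_numE ?diameter_ge0 //.
  by apply: le_lt_trans (U1 k) _; rewrite ltry.
have d0 k : 0 <= d k by rewrite -lee_fin -dE diameter_ge0.
have d1 k : d k <= 1 by rewrite -lee_fin -dE.
pose g := geom_radius t (e / 2).
have e20 : 0 < e / 2 by rewrite divr_gt0.
(* Doubling a positive diameter makes the open ball about any point of the set contain the set. *)
pose r k := if 0 < d k then 2 * d k else g k.
exists (fun k => get (U k)), r; split.
- move=> k; rewrite /r; case: ifP => [dk|_]; first by rewrite mulr_gt0.
  exact: geom_radius_gt0.
- move=> x /EU[k _ Ukx]; exists k => //.
  have dr : d k < r k.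
    rewrite /r; case: (ltP 0 (d k)) => [dk|]; first by rewrite ltr_pMl // ltr1n.
    by move=> /le_lt_trans; apply; apply: geom_radius_gt0.
  have gx : eucl_norm (get (U k) - x) <= d k.
    by rewrite -lee_fin -dE; apply: eucl_norm_le_diameter => //; apply: getPex; exists x.
  apply/ball_coordP; split; first exact: le_lt_trans dr.
    by have := coord_le_eucl_norm (get (U k) - x) 0; rewrite !mxE => /le_lt_trans;
      apply; apply: le_lt_trans dr.
  by have := coord_le_eucl_norm (get (U k) - x) 1; rewrite !mxE => /le_lt_trans;
      apply; apply: le_lt_trans dr.
move=> N.
have sumU : \sum_(k < N) (if 0 < d k then d k `^ t0 else 0) <= e'.
  rewrite -lee_fin -sumEFin; apply: le_trans (ltW Ue).
  apply: le_trans (nneseries_lim_ge N _) => [|k _ _]; last exact: diameter_pow_ge0.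
  rewrite -(big_mkord xpredT (fun k => (if 0 < d k then d k `^ t0 else 0)%:E)).
  apply: lee_sum => k _; case: ifP => [dk|_]; last exact: diameter_pow_ge0.
  rewrite /diameter_pow; case: eqP => [Uk|_]; last by rewrite dE poweR_EFin.
  exfalso; move: dk; apply/negP; rewrite -leNgt -lee_fin -dE Uk.
  apply: ge_ereal_sup => _ [->//|[p [[]]]].
have : \sum_(k < N) r k `^ t <=
   \sum_(k < N) (2 `^ t * (if 0 < d k then d k `^ t0 else 0) + (e / 2) / 2 ^+ k.+1).
  apply: ler_sum => k _; rewrite -(geom_radius_powR k t_gt0 e20) /r.
  case: ifP => [dk|_]; last by rewrite mulr0 add0r.
  rewrite powRM // -[leLHS]addr0 lerD ?powR_ge0 // ler_pM2l //.
  by apply: ger_powR; rewrite ?dk ?d1 // ltW.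
rewrite big_split /= -mulr_sumr => /le_trans; apply.
rewrite [leRHS](splitr e) lerD ?sum_geom //.
apply: le_trans (_ : 2 `^ t * e' <= _); first by rewrite ler_pM2l.
by rewrite /e' mulrC divfK // gt_eqF.
Qed.

Lemma hausdorff_null_dim s E : 0 < s -> null_dim s E -> hausdorff_measure s E = 0%E.
Proof.
move=> s0 nE; apply/eqP; rewrite eq_le; apply/andP; split; last first.
  apply: (@le_trans _ _ (hausdorff_premeasure s 1 E)); last first.
    by apply: ereal_sup_ubound; exists 1 => //=.
  apply: le_ereal_inf_tmp => _ [U _ <-]; apply: nneseries_ge0 => k _ _.
  exact: diameter_pow_ge0.
apply: ge_ereal_sup => _ [/= delta delta0 <-]; apply/lee_addgt0Pr => e e0.
rewrite add0e.
(* A sup-norm ball of radius r has Euclidean diameter at most 4 r. The first bound absorbs the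
   resulting factor 4^s, the second keeps all diameters below [delta]. *)
pose e' := Num.min (e / 4 `^ s) ((delta / 4) `^ s).
have p4 : 0 < 4 `^ s :> R by rewrite powR_gt0.
have e'0 : 0 < e' by rewrite lt_min divr_gt0 //= powR_gt0 // divr_gt0.
have [a [r [r0 Ear rt]]] := nE _ e'0.
have rd k : 4 * r k <= delta.
  have : r k `^ s <= (delta / 4) `^ s.
    have := rt k.+1; rewrite big_ord_recr /= le_min => /andP[_]; apply: le_trans.
    by rewrite lerDr sumr_ge0 // => i _; rewrite powR_ge0.
  move=> H; rewrite mulrC -ler_pdivlMr // leNgt; apply/negP => /(gt0_ltr_powR s0).
  by rewrite !nnegrE divr_ge0 ?ltW // => /(_ isT isT); rewrite ltNge H.
have tri k (u v w : R) : `|u - v| < r k -> `|u - w| < r k -> `|v - w| <= 2 * r k.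
  rewrite !ltr_norml ler_norml => /andP[? ?] /andP[? ?]; apply/andP; split; lra.
have diam k : (diameter (ball (a k) (r k)) <= (4 * r k)%:E)%E.
  apply: ge_ereal_sup => _ [->|[[x y] [/= /ball_coordP[_ x0 x1] /ball_coordP[_ y0 y1]] <-]].
    by rewrite lee_fin mulr_ge0 // ltW.
  rewrite lee_fin; have -> : 4 * r k = 2 * (2 * r k) by ring.
  by apply: eucl_norm_le; rewrite !mxE; [exact: tri x0 y0|exact: tri x1 y1].
apply: (@le_trans _ _ (\sum_(0 <= k <oo) diameter_pow s (ball (a k) (r k)))%E).
  apply: ereal_inf_lbound; exists (fun k => ball (a k) (r k)) => //; split => // k.
  by apply: le_trans (diam k) _; rewrite lee_fin.
apply: lime_le; first by apply: is_cvg_nneseries => k _ _; exact: diameter_pow_ge0.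
apply: nearW => N.
apply: (@le_trans _ _ (\sum_(0 <= k < N) ((4 * r k) `^ s)%:E)%E).
  apply: lee_sum => k _; rewrite /diameter_pow; case: ifP => _.
    by rewrite lee_fin powR_ge0.
  rewrite -poweR_EFin; apply: gt0_ler_poweR (diam k); first exact: ltW.
    by rewrite in_itv /= diameter_ge0 leey.
  by rewrite in_itv /= leey lee_fin mulr_ge0 // ltW.
rewrite sumEFin lee_fin big_mkord.
under eq_bigr => k _ do rewrite powRM // ?(ltW (r0 _)) //.
rewrite -mulr_sumr mulrC -ler_pdivlMr //; apply: le_trans (rt N) _.
by rewrite /e' ge_min lexx.
Qed.

End HausdorffNull.

(** * Dyadic squares *)

Section Dyadic.
Context {R : realType}.
Implicit Types (a x y : 'rV[R]_2) (E : set 'rV[R]_2).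

Definition dyadic (k : nat) x : int * int :=
  (Num.floor (2 ^+ k * x 0 0), Num.floor (2 ^+ k * x 0 1)).

Lemma floor_double_inj (u v : R) :
  Num.floor (2 * u) = Num.floor (2 * v) -> Num.floor u = Num.floor v.
Proof.
have half (a b : R) : Num.floor (2 * a) = Num.floor (2 * b) -> Num.floor a <= Num.floor b.
  move=> ab; rewrite floor_ge_int -(ler_pM2l (ltr0n _ 2)).
  have -> : 2%:R * (Num.floor a)%:~R = (2 * Num.floor a)%:~R :> R by rewrite intrM.
  rewrite -floor_ge_int -ab floor_ge_int intrM ler_pM2l //.
  by have /andP[] := floor_itv a.
by move=> uv; apply/eqP; rewrite eq_le !half.
Qed.

Lemma dyadic_nested k x y : dyadic k.+1 x = dyadic k.+1 y -> dyadic k x = dyadic k y.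
Proof.
case; rewrite !exprS -!mulrA => /floor_double_inj e0 /floor_double_inj e1.
by rewrite /dyadic e0 e1.
Qed.

Lemma floor_eq_itv (u : R) (n : int) : Num.floor u = n -> n%:~R <= u < n%:~R + 1.
Proof. by move=> <-; have := floor_itv u; rewrite intrD. Qed.

Lemma half_powR_lt1 (s : R) : 0 < s -> 2^-1 `^ s < 1.
Proof.
move=> s0; have := @gt0_ltr_powR _ _ s0 2^-1 1.
by rewrite powR1 !nnegrE; apply => //; rewrite invf_lt1 // ltr1n.
Qed.

Lemma powR_exp (b : R) (k : nat) (s : R) : 0 <= b -> (b ^+ k) `^ s = (b `^ s) ^+ k.
Proof.
by move=> b0; rewrite -(powR_mulrn _ b0) -powRrM mulrC powRrM powR_mulrn ?powR_ge0.
Qed.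

Definition dyadic_corner (c : nat * (int * int)) : 'rV[R]_2 :=
  \row_(i < 2) ((if i == 0 then c.2.1 else c.2.2)%:~R / 2 ^+ c.1).

Lemma dyadic_ball k x (c : int * int) : dyadic k x = c ->
  ball (dyadic_corner (k, c)) (2^-1 ^+ k) x.
Proof.
have p0 : 0 < 2 ^+ k :> R by rewrite exprn_gt0.
have near (u : R) (n : int) : Num.floor (2 ^+ k * u) = n -> `|n%:~R / 2 ^+ k - u| < 2^-1 ^+ k.
  move=> /floor_eq_itv /andP[n0 n1].
  rewrite -(ltr_pM2l p0) -{1}(gtr0_norm p0) -normrM mulrBr mulrCA divff ?gt_eqF // mulr1.
  rewrite -exprMn divff // expr1n ltr_norml; apply/andP; split; lra.
move=> <-; apply/ball_coordP; rewrite !mxE /=; split; first by rewrite exprn_gt0.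
  exact: near.
exact: near.
Qed.

Lemma null_dim_net_content (s : R) E : 0 < s ->
  (forall x y, E x -> E y -> dyadic 0 x = dyadic 0 y) ->
  net_content dyadic (2^-1 `^ s) E <= 0 -> null_dim s E.
Proof.
move=> s0 E0 hE; apply: (@null_dim_countable _ (nat * (int * int))%type) => // e e0.
have [W [cW bW]] := net_content_cover (2^-1 `^ s) E0 e0.
exists W, dyadic_corner.
exists (fun c => 2^-1 ^+ c.1); split.
- by move=> c _; rewrite exprn_gt0.
- by move=> x /cW[k Wk]; exists (k, dyadic k x) => //; apply: (dyadic_ball (x := x)).
- move=> l ul lW; apply: le_trans (_ : net_content dyadic (2^-1 `^ s) E + e <= _).
    by under eq_bigr => c _ do rewrite powR_exp //; exact: bW.
  lra.
Qed.

(** A unit square splits into 4^L squares of level [L]; one point of [E] is picked in each of those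
    that [E] meets. *)
Lemma dyadic_representatives E L : (forall x y, E x -> E y -> dyadic 0 x = dyadic 0 y) ->
  exists P : seq 'rV[R]_2, (forall p, p \in P -> E p) /\
    forall x, E x -> exists2 p, p \in P & dyadic L x = dyadic L p.
Proof.
move=> E0; have [[x0 Ex0]|nE] := pselect (exists x, E x); last first.
  by exists [::]; split => // x Ex; case: nE; exists x.
have fl (u : R) : exists2 n, (n < 2 ^ L)%N &
    Num.floor (2 ^+ L * u) = 2 ^+ L * Num.floor u + n%:Z.
  have /andP[u0 u1] := floor_itv u.
  have p0 : 0 < 2 ^+ L :> R by rewrite exprn_gt0.
  pose m := Num.floor (2 ^+ L * u) - 2 ^+ L * Num.floor u.
  have p2 : (2 ^+ L : int)%:~R = 2 ^+ L :> R by rewrite rmorphXn.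
  have m0 : 0 <= m by rewrite subr_ge0 floor_ge_int intrM p2 ler_pM2l.
  have m1 : m < 2 ^+ L.
    rewrite ltrBlDr -(ltr_int R); have /andP[H _] := floor_itv (2 ^+ L * u).
    apply: le_lt_trans H _; rewrite intrD intrM p2 -{2}[2 ^+ L]mulr1 -mulrDr ltr_pM2l //.
    by rewrite addrC -(intrD _ _ 1).
  exists `|m|%N; last by rewrite gez0_abs // /m addrC subrK.
  by rewrite -ltz_nat gez0_abs // -[X in _ < X]natz natrX.
pose c := dyadic 0 x0.
pose S := [seq (2 ^+ L * c.1 + i%:Z, 2 ^+ L * c.2 + j%:Z) |
  i <- iota 0 (2 ^ L), j <- iota 0 (2 ^ L)].
have ES x : E x -> dyadic L x \in S.
  move=> Ex; have := E0 _ _ Ex Ex0; rewrite -/c /dyadic !expr0 !mul1r => xc.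
  have [i il ie] := fl (x 0 0); have [j jl je] := fl (x 0 1).
  by apply/allpairsP; exists (i, j); rewrite !mem_iota -xc /= ie je.
pose f d := get [set x | E x /\ dyadic L x = d].
have fP d : (exists x, E x /\ dyadic L x = d) -> E (f d) /\ dyadic L (f d) = d.
  by move=> H; exact: (@getPex _ [set x | E x /\ dyadic L x = d]).
exists [seq f d | d <- S & `[< exists x, E x /\ dyadic L x = d >]]; split.
  by move=> p /mapP[d]; rewrite mem_filter => /andP[/asboolP/fP[? _] _] ->.
move=> x Ex; have xx : exists y, E y /\ dyadic L y = dyadic L x by exists x.
exists (f (dyadic L x)); last by have [] := fP _ xx.
by apply: map_f; rewrite mem_filter ES // andbT; apply/asboolP.
Qed.

Lemma dyadic_scale (r : R) L : 2^-1 ^+ L <= r -> r <= 1 ->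
  exists2 k, (k <= L)%N & r <= 2^-1 ^+ k <= 2 * r.
Proof.
elim: L => [|L IH] rL r1.
  by exists 0%N => //; rewrite expr0 r1 /=; move: rL; rewrite expr0; lra.
have [/IH[//|k kL kr]|Lr] := leP (2^-1 ^+ L) r; first by exists k => //; apply: leqW.
exists L => //; rewrite (ltW Lr) /=; move: rL; rewrite exprS; lra.
Qed.

(** A sup-norm ball of radius r <= 1 meets at most 9 squares of a level whose side is between r and
    2 r. For r > 1 the bound exceeds the total mass. *)
Lemma ball_mass (s : R) (P : seq 'rV[R]_2) (w : 'rV[R]_2 -> R) (L : nat) :
  0 < s -> (forall x, 0 <= w x) ->
  (forall k d, (k <= L)%N -> \sum_(p <- P | dyadic k p == d) w p <= (2^-1 `^ s) ^+ k) ->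
  \sum_(p <- P) w p <= 1 ->
  forall a r, 2^-1 ^+ L <= r ->
    \sum_(p <- P | `[< ball a r p >]) w p <= 9 * 2 `^ s * r `^ s.
Proof.
move=> s0 w0 wP w1 a r rL.
have r0 : 0 < r by apply: lt_le_trans rL; rewrite exprn_gt0.
have [r1|r1] := leP r 1; last first.
  apply: (@le_trans _ _ 1).
    apply: le_trans w1; rewrite big_mkcond /=; apply: ler_sum => p _.
    by case: ifP.
  have : 1 <= 2 `^ s :> R by rewrite -[leLHS](powRr0 2); apply: ler_powR; rewrite ?ler1n // ltW.
  have : 1 <= r `^ s by rewrite -[leLHS](powRr0 r); apply: ler_powR; rewrite ?ltW.
  nra.
have [k kL /andP[rk kr]] := dyadic_scale rL r1.
have p0 : 0 < 2 ^+ k :> R by rewrite exprn_gt0.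
pose n0 := Num.floor (2 ^+ k * a 0 0); pose n1 := Num.floor (2 ^+ k * a 0 1).
pose S := [seq (n0 + i, n1 + j) | i <- [:: -1; 0; 1], j <- [:: -1; 0; 1]].
have fl (u v : R) : `|u - v| < r -> Num.floor (2 ^+ k * v) \in
    [seq Num.floor (2 ^+ k * u) + i | i <- [:: -1; 0; 1]].
  move=> uv.
  have : `|2 ^+ k * u - 2 ^+ k * v| < 1.
    rewrite -mulrBr normrM gtr0_norm // -ltr_pdivlMl // mulr1.
    by apply: lt_le_trans uv _; rewrite -exprVn.
  rewrite ltr_norml => /andP[h0 h1].
  have := floor_itv (2 ^+ k * u); have := floor_itv (2 ^+ k * v).
  move: (Num.floor (2 ^+ k * u)) (Num.floor (2 ^+ k * v)) => m n.
  rewrite !intrD => /andP[g0 g1] /andP[f0 f1].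
  have mn : m < n + 2 by rewrite -(ltr_int R) intrD; lra.
  have nm : n < m + 2 by rewrite -(ltr_int R) intrD; lra.
  have : n = m + -1 \/ n = m + 0 \/ n = m + 1 by clear -mn nm; lia.
  by rewrite /= !inE => -[->|[->|->]]; rewrite eqxx ?orbT.
have sub p : ball a r p -> dyadic k p \in S.
  move=> /ball_coordP[_ /fl h0 /fl h1].
  have [i il ie] := mapP h0; have [j jl je] := mapP h1.
  by apply/allpairsP; exists (i, j); rewrite il jl /dyadic ie je.
apply: (@le_trans _ _ (\sum_(d <- S) \sum_(p <- P | dyadic k p == d) w p)).
  under [leRHS]eq_bigr => d _ do rewrite big_mkcond.
  rewrite exchange_big /= big_mkcond /=; apply: ler_sum => p _.
  case: asboolP => [/sub pS|_]; last by rewrite sumr_ge0 // => d _; case: ifP.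
  by rewrite (big_rem _ pS) /= eqxx lerDl sumr_ge0 // => d _; case: ifP.
apply: le_trans (_ : \sum_(d <- S) (2^-1 `^ s) ^+ k <= _).
  by apply: ler_sum => d _; apply: wP.
rewrite big_const_seq count_predT iter_addr_0 size_allpairs /= -[leLHS]mulr_natl -[leRHS]mulrA.
rewrite ler_pM2l // -powR_exp // -powRM ?(ltW r0) //.
by apply: ge0_ler_powR; rewrite ?nnegrE ?exprn_ge0 ?mulr_ge0 // ltW.
Qed.

End Dyadic.

(** * Radial projection of a line *)

Section LinePart.
Context {R : realType}.
Implicit Types (a x y n : 'rV[R]_2) (E K : set 'rV[R]_2).

Lemma null_dim_le s t E : 0 < t -> t <= s -> null_dim t E -> null_dim s E.
Proof.
(* Capping the sum at 1 forces every radius to be at most 1, where a larger exponent gives a smaller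
   power. *)
move=> t0 ts nE e e0; have e10 : 0 < Num.min e 1 by rewrite lt_min e0 ltr01.
have [a [r [r0 Ear rt]]] := nE _ e10; exists a, r; split => // N.
have rt1 k : r k `^ t <= 1.
  have := rt k.+1; rewrite big_ord_recr /= le_min => /andP[_]; apply: le_trans.
  by rewrite lerDr sumr_ge0 // => i _; rewrite powR_ge0.
have r1 k : r k <= 1.
  rewrite leNgt; apply/negP => /(gt0_ltr_powR t0).
  by rewrite powR1 !nnegrE ler01 ltW // => /(_ isT isT); rewrite ltNge rt1.
apply: (@le_trans _ _ (\sum_(k < N) r k `^ t)).
  by apply: ler_sum => k _; apply: ger_powR; rewrite // r0 r1.
by apply: le_trans (rt N) _; rewrite ge_min lexx.
Qed.

Lemma dyadic0_close x y i : dyadic 0 x = dyadic 0 y -> `|x 0 i - y 0 i| < 1.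
Proof.
have fl (u v : R) : Num.floor u = Num.floor v -> `|u - v| < 1.
  move=> uv; have := floor_itv u; have := floor_itv v; rewrite uv intrD.
  move=> /andP[? ?] /andP[? ?]; rewrite ltr_norml; apply/andP; split; lra.
by rewrite /dyadic !expr0 !mul1r => -[/fl h0 /fl h1]; move: i; apply: ord2P.
Qed.

Definition cross (u v : 'rV[R]_2) : R := u 0 0 * v 0 1 - u 0 1 * v 0 0.

Definition dot (u v : 'rV[R]_2) : R := u 0 0 * v 0 0 + u 0 1 * v 0 1.

Lemma crossZ (p q : R) (u v : 'rV[R]_2) : cross (p *: u) (q *: v) = p * q * cross u v.
Proof. by rewrite /cross !mxE; ring. Qed.

Definition direction x y : 'rV[R]_2 := (eucl_norm (x - y))^-1 *: (x - y).

Lemma eucl_norm_gt0 x : x != 0 -> 0 < eucl_norm x.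
Proof.
move=> x0; rewrite lt_neqAle eucl_norm_ge0 andbT; apply: contra_neq x0 => x0.
apply/rowP => i; rewrite mxE; apply/eqP; rewrite -normr_le0 x0.
exact: coord_le_eucl_norm.
Qed.

Lemma direction_scale x y : x != y -> eucl_norm (x - y) *: direction x y = x - y.
Proof.
move=> xy; rewrite /direction scalerA divff ?scale1r // gt_eqF //.
by rewrite eucl_norm_gt0 // subr_eq0.
Qed.

Lemma direction_unit x y : x != y ->
  direction x y 0 0 ^+ 2 + direction x y 0 1 ^+ 2 = 1.
Proof.
move=> xy; have dE i : direction x y 0 i = (eucl_norm (x - y))^-1 * (x - y) 0 i.
  by rewrite mxE.
rewrite !dE !exprMn -mulrDr -sqr_eucl_norm.
by rewrite exprVn mulVf // sqrf_eq0 gt_eqF // eucl_norm_gt0 // subr_eq0.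
Qed.

Lemma unit_coord (u v : R) : u ^+ 2 + v ^+ 2 = 1 -> `|u| <= 1 /\ `|v| <= 1.
Proof.
move=> uv; split; rewrite -(ler_pXn2r (n := 2)) ?nnegrE // expr1n real_normK ?num_real //.
  by rewrite -uv lerDl sqr_ge0.
by rewrite -uv lerDr sqr_ge0.
Qed.

Lemma cross_unit_close (u v : 'rV[R]_2) r : u 0 0 ^+ 2 + u 0 1 ^+ 2 = 1 ->
  `|u 0 0 - v 0 0| <= r -> `|u 0 1 - v 0 1| <= r -> `|cross u v| <= 2 * r.
Proof.
move=> /unit_coord[u0 u1] h0 h1.
have -> : cross u v = u 0 1 * (u 0 0 - v 0 0) - u 0 0 * (u 0 1 - v 0 1).
  by rewrite /cross; ring.
apply: le_trans (ler_normB _ _) _; rewrite !normrM.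
have -> : 2 * r = 1 * r + 1 * r by ring.
by apply: lerD; apply: ler_pM.
Qed.

Lemma ball_dist_le a x y r i : ball a r x -> ball a r y -> `|x 0 i - y 0 i| <= 2 * r.
Proof.
move=> /ball_coordP[_ x0 x1] /ball_coordP[_ y0 y1]; move: i.
by apply: ord2P; move: x0 y0 x1 y1; rewrite !ltr_norml ler_norml => /andP[? ?] /andP[? ?]
  /andP[? ?] /andP[? ?]; apply/andP; split; lra.
Qed.

(* Seen from a point off the line, the radial projection of the line is
   inverse-Lipschitz: twice the area of the triangle [x y z] is at once
   [|y - z| dist(x, line)] and [|x - y| |x - z| sin (angle at x)]. *)
Lemma null_dim_line (t D c : R) n x K E : 0 < t ->
  n 0 0 ^+ 2 + n 0 1 ^+ 2 = 1 -> dot n x != c -> K x -> E `<=` K ->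
  (forall y, E y -> dot n y = c) ->
  (forall y, E y -> eucl_norm (y - x) <= D) ->
  null_dim t (spanned_directions K) -> null_dim t E.
Proof.
move=> t0 n1 nx Kx EK En ED nS e e0.
pose d := `|c - dot n x|; have d0 : 0 < d by rewrite normr_gt0 subr_eq0 eq_sym.
have yx y : E y -> y != x by move=> /En; apply: contra_eqN => /eqP ->.
have ES y : E y -> spanned_directions K (direction y x).
  by move=> Ey; exists y, x; split; rewrite ?yx //; exact: EK.
pose M := 4 * D ^+ 2 / d + 1.
have M0 : 0 < M by rewrite ltr_wpDl // divr_ge0 ?(ltW d0) // mulr_ge0 // sqr_ge0.
have Mt : 0 < M `^ t by rewrite powR_gt0.
have [a [r [r0 Sar rt]]] := nS _ (divr_gt0 e0 Mt).
(* Each arc is traded for a ball about one point of [E] seen through it, larger by the factor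
   [M]. *)
pose b k := get [set y | E y /\ ball (a k) (r k) (direction y x)].
exists b, (fun k => M * r k); split.
- by move=> k; rewrite mulr_gt0.
- move=> y Ey; have [k _ yk] := Sar _ (ES y Ey); exists k => //.
  have [Eb bk] : E (b k) /\ ball (a k) (r k) (direction (b k) x).
    by apply: (@getPex _ [set y | E y /\ ball (a k) (r k) (direction y x)]); exists y.
  move: (b k) Eb bk => z Ez zk.
  have : `|cross (direction z x) (direction y x)| <= 4 * r k.
    have -> : 4 * r k = 2 * (2 * r k) by ring.
    by apply: cross_unit_close; [apply: direction_unit; exact: yx|apply: ball_dist_le zk yk..].
  set C := cross _ _ => Cr.
  have Ce : cross (z - x) (y - x) = eucl_norm (z - x) * eucl_norm (y - x) * C.
    have := crossZ (eucl_norm (z - x)) (eucl_norm (y - x)) (direction z x) (direction y x).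
    by rewrite !direction_scale // yx.
  have Cd : `|cross (z - x) (y - x)| <= D ^+ 2 * (4 * r k).
    rewrite Ce normrM normrM !(ger0_norm (eucl_norm_ge0 _)) expr2.
    by apply: ler_pM => //; [rewrite mulr_ge0 ?eucl_norm_ge0|apply: ler_pM; rewrite ?eucl_norm_ge0 ?ED].
  (* As [y] and [z] are on the line, a coordinate of z - y times the distance from [x] to the line
     is, up to sign, a coordinate of the normal times twice the area of the triangle. *)
  have key (u v w : R) : u ^+ 2 + w ^+ 2 = 1 ->
      v * (c - dot n x) = u * cross (z - x) (y - x) -> `|v| < M * r k.
    move=> /unit_coord[u1 _] H.
    have : `|v| * d <= D ^+ 2 * (4 * r k).
      rewrite -normrM H normrM; apply: le_trans (_ : 1 * (D ^+ 2 * (4 * r k)) <= _).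
        by apply: ler_pM.
      by rewrite mul1r.
    rewrite -ler_pdivlMr // => /le_lt_trans; apply.
    have -> : D ^+ 2 * (4 * r k) / d = 4 * D ^+ 2 / d * r k by ring.
    by rewrite ltr_pM2r // /M ltrDl.
  have ze := En _ Ez; have ye := En _ Ey.
  apply/ball_coordP; split; first by rewrite mulr_gt0.
  + apply: (key (n 0 1) _ (n 0 0)); first by rewrite addrC.
    have -> : (z 0 0 - y 0 0) * (c - dot n x) =
       (z 0 0 - x 0 0) * (dot n y - dot n x) - (y 0 0 - x 0 0) * (dot n z - dot n x).
      by rewrite ze ye; ring.
    by rewrite /cross /dot !mxE; ring.
  + apply: (key (- n 0 0) _ (n 0 1)); first by rewrite sqrrN.
    have -> : (z 0 1 - y 0 1) * (c - dot n x) =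
       (z 0 1 - x 0 1) * (dot n y - dot n x) - (y 0 1 - x 0 1) * (dot n z - dot n x).
      by rewrite ze ye; ring.
    by rewrite /cross /dot !mxE; ring.
- move=> N; under eq_bigr => k _ do rewrite powRM ?(ltW M0) ?(ltW (r0 _)) //.
  by rewrite -mulr_sumr mulrC -ler_pdivlMr.
Qed.


End LinePart.

(** * Pairs of weighted points *)

Section WeightedPoints.
Context {R : realType}.
Variables (P : seq 'rV[R]_2) (w : 'rV[R]_2 -> R).
Hypothesis w_ge0 : forall x, 0 <= w x.
Implicit Types (a x y z n : 'rV[R]_2) (A B : set 'rV[R]_2) (G H : 'rV[R]_2 -> set 'rV[R]_2).

Definition mass A := \sum_(p <- P) w p * (`[< A p >])%:R.

Definition mass2 G := \sum_(x <- P) w x * mass (G x).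

Lemma mass_ge0 A : 0 <= mass A.
Proof. by apply: sumr_ge0 => p _; rewrite mulr_ge0. Qed.

Lemma mass_le A B : (forall p, p \in P -> A p -> B p) -> mass A <= mass B.
Proof.
move=> AB; rewrite /mass big_seq [leRHS]big_seq; apply: ler_sum => p pP.
rewrite ler_wpM2l // ler_nat; case: asboolP => // Ap.
by rewrite asboolT //; exact: AB.
Qed.

Lemma mass_le_seq (I : eqType) (l : seq I) (B : I -> set 'rV[R]_2) A :
  (forall p, p \in P -> A p -> exists2 i, i \in l & B i p) ->
  mass A <= \sum_(i <- l) mass (B i).
Proof.
move=> AB; rewrite /mass exchange_big /= big_seq [leRHS]big_seq; apply: ler_sum => p pP.
rewrite -mulr_sumr ler_wpM2l // -natr_sum ler_nat; case: asboolP => // /(AB p pP)[i il Bi].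
by rewrite (big_rem i) //= asboolT.
Qed.

Lemma mass_setU_setI A B : mass (A `|` B) + mass (A `&` B) = mass A + mass B.
Proof.
rewrite /mass -!big_split /=; apply: eq_bigr => p _; rewrite -!mulrDr -!natrD.
congr (_ * _%:R); rewrite asbool_or asbool_and.
by case: `[< A p >]; case: `[< B p >].
Qed.

Lemma mass2_le_seq (I : eqType) (l : seq I) (H : I -> 'rV[R]_2 -> set 'rV[R]_2) G :
  (forall x y, x \in P -> y \in P -> G x y -> exists2 i, i \in l & H i x y) ->
  mass2 G <= \sum_(i <- l) mass2 (H i).
Proof.
move=> GH; rewrite /mass2 exchange_big /= big_seq [leRHS]big_seq; apply: ler_sum => x xP.
by rewrite -mulr_sumr ler_wpM2l //; apply: mass_le_seq => y yP; exact: GH.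
Qed.

Lemma mass2_square A : mass2 (fun x y => A x /\ A y) = mass A ^+ 2.
Proof.
rewrite expr2 /mass2 [in RHS]/mass mulr_suml; apply: eq_bigr => x _.
rewrite -mulrA; congr (_ * _); case: asboolP => Ax; last first.
  rewrite mul0r /mass big1 // => p _.
  by rewrite asboolF ?mulr0 // => -[].
rewrite mul1r; congr mass; apply/seteqP.
by split => [y []|y].
Qed.

Hypothesis total_le1 : mass setT <= 1.
Hypothesis P_diam : forall x y i, x \in P -> y \in P -> `|x 0 i - y 0 i| <= 1.
Variables (C s delta : R).
Hypothesis C_ge0 : 0 <= C.
Hypothesis ball_le : forall a r, delta <= r -> mass (ball a r) <= C * r `^ s.

Lemma mass_le1 A : mass A <= 1.
Proof. by apply: le_trans total_le1; apply: mass_le. Qed.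

(* Cauchy-Schwarz, as [0 <= sum w (d - g)^2] where [g] is the mean of the degree
   [d]. *)
Lemma sqr_mass2_le G : mass2 G ^+ 2 <=
  \sum_(x <- P) \sum_(y <- P) w x * w y * mass (fun z => G x z /\ G y z).
Proof.
pose d z := \sum_(x <- P) w x * (`[< G x z >])%:R.
have gE : mass2 G = \sum_(z <- P) w z * d z.
  rewrite /mass2 /mass; under eq_bigr => x _ do rewrite mulr_sumr.
  rewrite exchange_big /=; apply: eq_bigr => z _; rewrite mulr_sumr.
  by apply: eq_bigr => x _; ring.
have d2E : \sum_(x <- P) \sum_(y <- P) w x * w y * mass (fun z => G x z /\ G y z) =
    \sum_(z <- P) w z * d z ^+ 2.
  under eq_bigr => x _.
    under eq_bigr => y _ do rewrite /mass mulr_sumr.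
    rewrite exchange_big; over.
  rewrite exchange_big /=; apply: eq_bigr => z _.
  rewrite expr2 {1}/d mulr_suml mulr_sumr; apply: eq_bigr => x _.
  rewrite /d mulr_sumr mulr_sumr; apply: eq_bigr => y _.
  by rewrite asbool_and -mulnb natrM mulrCA mulrACA.
rewrite d2E; set g := mass2 G in gE *.
have : 0 <= \sum_(z <- P) w z * (d z - g) ^+ 2.
  by apply: sumr_ge0 => z _; rewrite mulr_ge0 // sqr_ge0.
have -> : \sum_(z <- P) w z * (d z - g) ^+ 2 =
    \sum_(z <- P) w z * d z ^+ 2 - 2 * g * g + g ^+ 2 * mass setT.
  have -> : 2 * g * g = \sum_(z <- P) 2 * g * (w z * d z) by rewrite -mulr_sumr -gE.
  rewrite /mass mulr_sumr -sumrB -big_split /=; apply: eq_bigr => z _.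
  by rewrite asboolT // mulr1; ring.
have : g ^+ 2 * mass setT <= g ^+ 2 by rewrite ler_piMr // sqr_ge0.
move: (\sum_(z <- P) _) (g ^+ 2 * _) => S T; rewrite expr2 => ? ?; lra.
Qed.

Definition strip n (c v : R) : set 'rV[R]_2 := [set z | `|dot n z - c| <= v].

Definition heavy (m v : R) n (c : R) :=
  n 0 0 ^+ 2 + n 0 1 ^+ 2 = 1 /\ m <= mass (strip n c v).

Definition heavy_pair (m v : R) x y :=
  exists n c, [/\ heavy m v n c, strip n c v x & strip n c v y].

Definition arc_pair (Theta : seq 'rV[R]_2) (r : R) x y :=
  x != y /\ exists2 a, a \in Theta & ball a r (direction x y).

Lemma P_eucl_diam x y : x \in P -> y \in P -> eucl_norm (x - y) <= 2.
Proof.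
move=> xP yP; have -> : 2 = 2 * 1 :> R by rewrite mulr1.
by apply: eucl_norm_le; rewrite !mxE; apply: P_diam.
Qed.

(** The vector z - z' is nearly parallel to both e = [direction x z] and f = [direction y z]: its
    cross products with them are at most 8 r. Since distances are at most 2, |cross e f| > v^2 / 4,
    and Cramer's rule bounds the coordinates of z - z' by 64 r / v^2; the constant 65 makes this
    strict. *)
Lemma crossing_arcs (v r : R) a b x y z z' :
  0 < v -> 0 < r -> x \in P -> y \in P -> z \in P -> z' \in P ->
  x != z -> y != z -> x != z' -> y != z' ->
  ball a r (direction x z) -> ball a r (direction x z') ->
  ball b r (direction y z) -> ball b r (direction y z') ->
  v ^+ 2 < `|cross (x - z) (y - z)| -> ball z (65 * r / v ^+ 2) z'.
Proof.
move=> v0 r0 xP yP zP z'P xz yz xz' yz' az az' bz bz' vx.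
pose e := direction x z; pose f := direction y z.
have v20 : 0 < v ^+ 2 by rewrite exprn_gt0.
have side p (d : 'rV[R]_2) : p \in P -> p != z -> p != z' -> ball d r (direction p z) ->
    ball d r (direction p z') -> `|cross (z - z') (direction p z)| <= 8 * r.
  move=> pP pz pz' dz dz'.
  have -> : cross (z - z') (direction p z) =
      - (eucl_norm (p - z') * cross (direction p z) (direction p z')).
    have -> : z - z' = eucl_norm (p - z') *: direction p z' - eucl_norm (p - z) *: direction p z.
      by rewrite !direction_scale //; apply/rowP => i; rewrite !mxE; ring.
    by rewrite /cross; set u := direction p z; set u' := direction p z'; rewrite !mxE; ring.
  rewrite normrN normrM (ger0_norm (eucl_norm_ge0 _)).
  have -> : 8 * r = 2 * (2 * (2 * r)) by ring.
  apply: ler_pM; rewrite ?eucl_norm_ge0 ?P_eucl_diam //.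
  by apply: cross_unit_close; [exact: direction_unit|exact: ball_dist_le dz dz'..].
have ze := side x a xP xz xz' az az'; have zf := side y b yP yz yz' bz bz'.
have ef : v ^+ 2 / 4 < `|cross e f|.
  have := crossZ (eucl_norm (x - z)) (eucl_norm (y - z)) e f.
  rewrite !direction_scale // => E1; move: vx; rewrite E1 normrM normrM.
  rewrite !(ger0_norm (eucl_norm_ge0 _)) => /lt_le_trans vx.
  rewrite ltr_pdivrMr // mulrC; apply: vx.
  rewrite ler_wpM2r //; have -> : 4 = 2 * 2 :> R by rewrite -natrM.
  by apply: ler_pM; rewrite ?eucl_norm_ge0 ?P_eucl_diam.
have key (t p q : R) : `|p| <= 1 -> `|q| <= 1 ->
    t * cross e f = p * cross (z - z') f - q * cross (z - z') e -> `|t| < 65 * r / v ^+ 2.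
  move=> p1 q1 E1.
  have : `|t| * `|cross e f| <= 16 * r.
    rewrite -normrM E1; apply: le_trans (ler_normB _ _) _; rewrite !normrM.
    have -> : 16 * r = 1 * (8 * r) + 1 * (8 * r) by ring.
    by apply: lerD; apply: ler_pM.
  move=> H; rewrite ltr_pdivlMr //.
  have : `|t| * (v ^+ 2 / 4) <= `|t| * `|cross e f| by rewrite ler_wpM2l // ltW.
  lra.
have [e0 e1] := unit_coord (direction_unit xz).
have [f0 f1] := unit_coord (direction_unit yz).
apply/ball_coordP; split; first by rewrite divr_gt0 // mulr_gt0.
- by apply: (key _ (e 0 0) (f 0 0)) => //; rewrite /cross ![(z - z') 0 _]mxE ![(- z') 0 _]mxE; ring.
- by apply: (key _ (e 0 1) (f 0 1)) => //; rewrite /cross ![(z - z') 0 _]mxE ![(- z') 0 _]mxE; ring.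
Qed.

(** With [n] the unit normal of the line through [x] and [y], the distance from [z] to this line is
    the cross product divided by the length of y - x, which is at least [v]. *)
Lemma collinear_strip (v : R) x y : 0 < v -> v <= eucl_norm (y - x) ->
  exists n, n 0 0 ^+ 2 + n 0 1 ^+ 2 = 1 /\ forall z,
    `|cross (z - x) (y - x)| <= v ^+ 2 -> strip n (dot n x) v z.
Proof.
move=> v0 vxy; set L := eucl_norm (y - x) in vxy *.
have L0 : 0 < L by apply: lt_le_trans vxy.
pose n : 'rV[R]_2 := \row_(i < 2) (if i == 0 then (y - x) 0 1 / L else - (y - x) 0 0 / L).
have n0E : n 0 0 = (y - x) 0 1 / L by rewrite [LHS]mxE.
have n1E : n 0 1 = - (y - x) 0 0 / L by rewrite [LHS]mxE.
exists n; split.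
  rewrite n0E n1E !exprMn sqrrN -mulrDl addrC -sqr_eucl_norm exprVn divff //.
  by rewrite sqrf_eq0 gt_eqF.
move=> z zv; rewrite /strip /=.
have -> : dot n z - dot n x = cross (z - x) (y - x) / L.
  rewrite /dot n0E n1E /cross ![(z - x) 0 _]mxE ![(- x) 0 _]mxE.
  by move: ((y - x) 0 0) ((y - x) 0 1) => ? ?; ring.
rewrite normrM normfV (gtr0_norm L0) ler_pdivrMr //; apply: le_trans zv _.
by rewrite expr2 ler_wpM2l // ltW.
Qed.

(* Few arcs carry few pairs: if [x] and [y] both see [z] through the arcs, then
   either [z] is in one of the at most [N^2] small intersections of tubes, or
   [x], [y] and [z] are nearly collinear, or [x] and [y] are close. *)
Lemma arc_pairs_mass2 (Theta : seq 'rV[R]_2) (m v r : R) :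
  0 < s -> 0 < v -> 0 < r -> 0 < m -> delta <= v -> delta <= 65 * r / v ^+ 2 ->
  C * v `^ s <= m ->
  (size Theta)%:R ^+ 2 * (C * (65 * r / v ^+ 2) `^ s) <= m ->
  mass2 (fun x y => arc_pair Theta r x y /\ ~ heavy_pair m v x y) ^+ 2 <= 3 * m.
Proof.
move=> s0 v0 r0 m0 dv dr Cv Tr.
set G := fun x y => _; apply: le_trans (sqr_mass2_le _) _.
(* If [x] and [y] are close the trivial bound 1 is used. Otherwise the points [z] nearly collinear
   with them and the remaining ones contribute at most [m] each. *)
have inner x y : x \in P -> y \in P ->
    mass (fun z => G x z /\ G y z) <= (`[< ball x v y >])%:R + 2 * m.
  move=> xP yP; case: asboolP => [xy|xy].
    by apply: le_trans (mass_le1 _) _; rewrite lerDl mulr_ge0 // ltW.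
  have vxy : v <= eucl_norm (y - x).
    rewrite leNgt; apply/negP => yx; apply: xy; apply/ball_coordP; split => //.
      by have := coord_le_eucl_norm (y - x) 0; rewrite !mxE distrC => /le_lt_trans; apply.
    by have := coord_le_eucl_norm (y - x) 1; rewrite !mxE distrC => /le_lt_trans; apply.
  have [n [n1 nz]] := collinear_strip v0 vxy.
  pose flat z := `|cross (z - x) (y - x)| <= v ^+ 2.
  pose A z := [/\ G x z, G y z & flat z].
  pose B (ab : 'rV[R]_2 * 'rV[R]_2) z := [/\ x != z /\ y != z, ball ab.1 r (direction x z),
     ball ab.2 r (direction y z) & ~ flat z].
  have -> : (0%:R : R) + 2 * m = m + m by rewrite add0r mulr_natl mulr2n.
  apply: (@le_trans _ _ (mass (A `|` (fun z => [/\ G x z, G y z & ~ flat z])))).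
    apply: mass_le => z _ [Gx Gy]; have [fz|fz] := pselect (flat z); first by left.
    by right.
  have := mass_setU_setI A (fun z => [/\ G x z, G y z & ~ flat z]).
  have := mass_ge0 (A `&` (fun z => [/\ G x z, G y z & ~ flat z])).
  (* Were the strip along [x] and [y] heavier than [m], any [z] in [A] would form a heavy pair with
     [x], against [G x z]. *)
  have mA : mass A <= m.
    have [[z zP Az]|nA] := pselect (exists2 z, z \in P & A z); last first.
      apply: le_trans (ltW m0); rewrite /mass big_seq big1 // => p pP.
      by rewrite asboolF ?mulr0 // => Ap; apply: nA; exists p.
    apply: (@le_trans _ _ (mass (strip n (dot n x) v))).
      by apply: mass_le => p _ [_ _ /nz].
    rewrite leNgt; apply/negP => mT; have [[_ nh] _ /nz zT] := Az; apply: nh.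
    exists n, (dot n x); split => //; first by split => //; apply: ltW.
    by rewrite /strip /= subrr normr0 ltW.
  (* For each pair of arcs, the non-flat [z] seen through both lie in one small ball about any of
     them, by [crossing_arcs]. *)
  have mB : mass (fun z => [/\ G x z, G y z & ~ flat z]) <= m.
    apply: le_trans Tr.
    apply: (@le_trans _ _ (\sum_(ab <- [seq (a, b) | a <- Theta, b <- Theta]) mass (B ab))).
      apply: mass_le_seq => z zP [[[xz [a aT az]] _] [[yz [b bT bz]] _] fz].
      by exists (a, b) => //; apply/allpairsP; exists (a, b).
    apply: (@le_trans _ _ (\sum_(ab <- [seq (a, b) | a <- Theta, b <- Theta])
        C * (65 * r / v ^+ 2) `^ s)); last first.
      by rewrite big_const_seq count_predT iter_addr_0 size_allpairs -[leLHS]mulr_natl natrM expr2.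
    apply: ler_sum => ab _.
    have [[z zP Bz]|nB] := pselect (exists2 z, z \in P & B ab z); last first.
      apply: (@le_trans _ _ 0); last by rewrite mulr_ge0 ?powR_ge0.
      rewrite /mass big_seq big1 // => p pP.
      by rewrite asboolF ?mulr0 // => Bp; apply: nB; exists p.
    apply: le_trans (ball_le z dr); apply: mass_le => p pP [[xp yp] ap bp fp].
    have [[xz yz] az bz fz] := Bz.
    apply: (crossing_arcs (a := ab.1) (b := ab.2) v0 r0 xP yP zP pP) => //.
    rewrite ltNge; apply/negP => H; apply: fz; rewrite /flat.
    have -> : cross (z - x) (y - x) = - cross (x - z) (y - z).
      by rewrite /cross !mxE; ring.
    by rewrite normrN.
  lra.
apply: (@le_trans _ _ (\sum_(x <- P) w x *
    \sum_(y <- P) (w y * (`[< ball x v y >])%:R + w y * (2 * m)))).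
  rewrite big_seq [leRHS]big_seq; apply: ler_sum => x xP.
  rewrite mulr_sumr big_seq [leRHS]big_seq; apply: ler_sum => y yP.
  rewrite -mulrDr -mulrA ler_wpM2l // ler_wpM2l //; exact: inner.
apply: (@le_trans _ _ (\sum_(x <- P) w x * (3 * m))).
  apply: ler_sum => x _; rewrite ler_wpM2l // big_split /= -mulr_suml.
  have -> : 3 * m = m + 1 * (2 * m) by ring.
  apply: lerD; first by apply: le_trans Cv; exact: ball_le.
  apply: ler_wpM2r; first by rewrite mulr_ge0 // ltW.
  apply: le_trans total_le1; rewrite /mass; apply: ler_sum => y _.
  by rewrite asboolT // mulr1.
rewrite -mulr_suml -[leRHS]mul1r; apply: ler_wpM2r; first by rewrite mulr_ge0 // ltW.
apply: le_trans total_le1; rewrite /mass; apply: ler_sum => y _.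
by rewrite asboolT // mulr1.
Qed.

(** If |cross n' n| > v' / 4, common points of the strips differ by at most 16 v / v' in each
    coordinate, so the intersection lies in a ball. Otherwise, starting from a common point, the
    second strip leaves the centre of the first by at most v + 2 v + v' / 2 within the set [P] of
    diameter 1, and this is at most v'. *)
Lemma strip_setI_mass n c n' c' (v v' : R) :
  n 0 0 ^+ 2 + n 0 1 ^+ 2 = 1 -> n' 0 0 ^+ 2 + n' 0 1 ^+ 2 = 1 ->
  0 < v -> 0 < v' -> 6 * v <= v' -> delta <= 17 * v / v' ->
  mass (strip n c v `&` strip n' c' v) <= C * (17 * v / v') `^ s \/
  forall z, z \in P -> strip n' c' v z -> strip n c v' z.
Proof.
move=> n1 n'1 v0 v'0 vv' dv.
have [[z0 z0P [z0n z0n']]|nz] :=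
  pselect (exists2 z, z \in P & (strip n c v `&` strip n' c' v) z); last first.
  left; apply: (@le_trans _ _ 0); last by rewrite mulr_ge0 ?powR_ge0.
  rewrite /mass big_seq big1 // => p pP.
  by rewrite asboolF ?mulr0 // => Hp; apply: nz; exists p.
have [a4|a4] := leP (`|cross n' n|) (v' / 4).
  right => z zP zn'; rewrite /strip /=.
  (* Expansion of [n] in the orthonormal frame given by [n'] and its rotation. *)
  have : dot n z - dot n z0 =
      dot n n' * (dot n' z - dot n' z0) + cross n' n * cross n' (z - z0).
    have -> : dot n z - dot n z0 = (n' 0 0 ^+ 2 + n' 0 1 ^+ 2) * (dot n z - dot n z0).
      by rewrite n'1 mul1r.
    by rewrite /dot /cross ![(z - z0) 0 _]mxE ![(- z0) 0 _]mxE; ring.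
  have nn' : `|dot n n'| <= 1.
    have e1 : dot n n' ^+ 2 + cross n' n ^+ 2 = 1.
      by rewrite -(mulr1 1) -{1}n1 -n'1 /dot /cross; ring.
    by have [] := unit_coord e1.
  have zc : `|cross n' (z - z0)| <= 2.
    have [h0 h1] := unit_coord n'1.
    rewrite /cross; apply: le_trans (ler_normB _ _) _; rewrite !normrM !mxE.
    have -> : 2 = 1 * 1 + 1 * 1 :> R by ring.
    by apply: lerD; apply: ler_pM => //; apply: P_diam.
  have d2 : `|dot n' z - dot n' z0| <= 2 * v.
    move: zn' z0n'; rewrite /strip /= !ler_norml => /andP[? ?] /andP[? ?].
    by apply/andP; split; lra.
  have : `|dot n n' * (dot n' z - dot n' z0)| <= 1 * (2 * v) by rewrite normrM; apply: ler_pM.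
  have : `|cross n' n * cross n' (z - z0)| <= v' / 4 * 2 by rewrite normrM; apply: ler_pM.
  move: z0n; rewrite /strip /= !ler_norml => /andP[? ?] /andP[? ?] /andP[? ?] E1.
  by apply/andP; split; lra.
left; apply: le_trans (ball_le z0 dv); apply: mass_le => z zP [zn zn'].
have v'40 : 0 < v' / 4 by rewrite divr_gt0.
have two (u u' c0 : R) : `|u - c0| <= v -> `|u' - c0| <= v -> `|u - u'| <= 2 * v.
  by rewrite !ler_norml => /andP[? ?] /andP[? ?]; apply/andP; split; lra.
have dn := two _ _ _ z0n zn; have dn' := two _ _ _ z0n' zn'.
have key (t p q : R) : `|p| <= 1 -> `|q| <= 1 ->
    t * cross n' n = p * (dot n z0 - dot n z) - q * (dot n' z0 - dot n' z) ->
    `|t| < 17 * v / v'.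
  move=> p1 q1 E1.
  have : `|t| * `|cross n' n| <= 4 * v.
    rewrite -normrM E1; apply: le_trans (ler_normB _ _) _; rewrite !normrM.
    have -> : 4 * v = 1 * (2 * v) + 1 * (2 * v) by ring.
    by apply: lerD; apply: ler_pM.
  have : `|t| * (v' / 4) <= `|t| * `|cross n' n| by rewrite ler_wpM2l // ltW.
  by rewrite ltr_pdivlMr //; lra.
have [p0 p1] := unit_coord n1; have [q0 q1] := unit_coord n'1.
apply/ball_coordP; split; first by rewrite divr_gt0 // mulr_gt0.
- by apply: (key _ (- n' 0 1) (- n 0 1)); rewrite ?normrN // /dot /cross; ring.
- by apply: (key _ (n' 0 0) (n 0 0)) => //; rewrite /dot /cross; ring.
Qed.

Definition line_strip (v : R) (l : 'rV[R]_2 * R) := strip l.1 l.2 v.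

Fixpoint transversal (m v beta : R) (l : seq ('rV[R]_2 * R)) : Prop :=
  if l is t :: l' then
    [/\ heavy m v t.1 t.2,
        forall u, u \in l' -> mass (line_strip v u `&` line_strip v t) <= beta &
        transversal m v beta l']
  else True.

Lemma transversal_heavy m v beta l t : transversal m v beta l -> t \in l ->
  heavy m v t.1 t.2.
Proof.
elim: l => [//|u l IH] [hu _ tl]; rewrite inE => /orP[/eqP -> //|]; exact: IH.
Qed.

(** Inclusion-exclusion cut after the pairwise terms: each strip adds at least [m] minus its
    overlaps with the others. *)
Lemma transversal_size m v beta l : 0 <= beta -> transversal m v beta l ->
  (size l)%:R * m <= mass [set z | exists2 t, t \in l & line_strip v t z] + (size l)%:R ^+ 2 * beta.
Proof.
move=> b0; elim: l => [|t l IH] => [_|[[_ ht] tl /IH {}IH]].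
  by rewrite mul0r addr_ge0 ?mass_ge0 // mulr_ge0 // sqr_ge0.
set U := [set z | exists2 u, u \in l & line_strip v u z] in IH.
have mU : mass (line_strip v t `|` U) <= mass [set z | exists2 u, u \in t :: l & line_strip v u z].
  apply: mass_le => z _ [zt|[u ul zu]]; first by exists t; rewrite ?mem_head.
  by exists u => //; rewrite inE ul orbT.
have mI : mass (line_strip v t `&` U) <= (size l)%:R * beta.
  apply: (@le_trans _ _ (\sum_(u <- l) mass (line_strip v u `&` line_strip v t))).
    by apply: mass_le_seq => z _ [zt [u ul zu]]; exists u.
  apply: (@le_trans _ _ (\sum_(u <- l) beta)).
    by rewrite big_seq [leRHS]big_seq; apply: ler_sum => u /tl.
  by rewrite big_const_seq count_predT iter_addr_0 -[leLHS]mulr_natl.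
have := mass_setU_setI (line_strip v t) U.
rewrite /= -natr1; move: ht; rewrite -/(line_strip v t) => ht.
have : 0 <= (size l)%:R * beta by rewrite mulr_ge0.
move: (size l)%:R IH mU mI => N; rewrite !expr2; nra.
Qed.

(** Extend a list greedily. A list of length N0, where 2 / m < N0 <= 3 / m, is impossible by
    [transversal_size]: N0 m exceeds 2, while the mass of the union and the overlaps are at most 1
    each. So the extension stops earlier, at a list that every heavy strip overlaps. *)
Lemma maximal_transversal (m v beta : R) : 0 < m -> m <= 1 -> 0 <= beta -> beta <= m ^+ 2 / 9 ->
  exists l, [/\ transversal m v beta l, (size l)%:R * m <= 2 &
    forall t, heavy m v t.1 t.2 ->
      exists2 u, u \in l & beta < mass (line_strip v u `&` line_strip v t)].
Proof.
move=> m0 m1 b0 bm.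
have step k : (exists2 l, transversal m v beta l & size l = k) \/
    exists l, [/\ transversal m v beta l, (size l < k)%N &
     forall t, heavy m v t.1 t.2 ->
      exists2 u, u \in l & beta < mass (line_strip v u `&` line_strip v t)].
  elim: k => [|k [[l tl lk]|[l [tl lk lmax]]]]; first by left; exists [::].
    have [[t ht nt]|nE] := pselect (exists2 t, heavy m v t.1 t.2 &
        ~ exists2 u, u \in l & beta < mass (line_strip v u `&` line_strip v t)).
      left; exists (t :: l); last by rewrite /= lk.
      split => // u ul; rewrite leNgt; apply/negP => bu; apply: nt; by exists u.
    right; exists l; split => //; first by rewrite lk.
    by move=> t ht; apply: contrapT => nt; apply: nE; exists t.
  by right; exists l; split => //; apply: leqW.
pose N0 := (Num.truncn (2 / m)).+1.
have N0lt : 2 / m < N0%:R by apply: truncnS_gt.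
have N0le : N0%:R <= 3 / m.
  rewrite /N0 -natr1; have : (Num.truncn (2 / m))%:R <= 2 / m.
    by rewrite truncn_le divr_ge0 // ltW.
  have : 1 <= m^-1 by rewrite invf_ge1.
  by lra.
have [[l tl lN]|[l [tl lN lmax]]] := step N0; last first.
  exists l; split => //; rewrite -ler_pdivlMr //.
  by apply: le_trans (_ : (Num.truncn (2 / m))%:R <= _);
    [rewrite ler_nat -ltnS|rewrite truncn_le divr_ge0 // ltW].
exfalso; have := transversal_size b0 tl; rewrite lN.
have := mass_le1 [set z | exists2 t, t \in l & line_strip v t z].
have : 2 < N0%:R * m by rewrite -ltr_pdivrMr.
have : N0%:R ^+ 2 * beta <= 1.
  apply: le_trans (_ : (3 / m) ^+ 2 * (m ^+ 2 / 9) <= _).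
    apply: ler_pM => //.
    by rewrite lerXn2r // nnegrE // divr_ge0 // ltW.
  have -> : (3 / m) ^+ 2 * (m ^+ 2 / 9) = 1 by field; rewrite gt_eqF.
  exact: lexx.
lra.
Qed.

(* Heavy strips are few, and one that stays light after thickening contains
   few pairs. *)
Lemma heavy_pairs_mass2 (m v v' : R) :
  0 < m -> m <= 1 -> 0 < v -> 0 < v' -> 6 * v <= v' -> delta <= 17 * v / v' ->
  C * (17 * v / v') `^ s <= m ^+ 2 / 9 ->
  mass2 (fun x y => heavy_pair m v x y /\ ~ heavy_pair (4 * m) v' x y) <= 32 * m.
Proof.
move=> m0 m1 v0 v'0 vv' dv bm.
have b0 : 0 <= C * (17 * v / v') `^ s by rewrite mulr_ge0 ?powR_ge0.
have [l [tl lm lmax]] := maximal_transversal v m0 m1 b0 bm.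
pose S t x y := line_strip v' t x /\ line_strip v' t y.
(* The strip of such a pair lies, within [P], in the thickening of a member of [l], which is light
   since the pair is not heavy at the coarser scale. At most 2 / m members with at most (4 m)^2
   pairs each give 32 m. *)
apply: (@le_trans _ _ (\sum_(t <- [seq t <- l | mass (line_strip v' t) < 4 * m]) mass2 (S t))).
  apply: mass2_le_seq => x y xP yP [[n [c [hn xn yn]]] nh].
  have [t tl' bt] := lmax (n, c) hn.
  have [t1 _] := transversal_heavy tl tl'.
  have sub z : z \in P -> strip n c v z -> line_strip v' t z.
    have [n1 _] := hn.
    have [H|] := strip_setI_mass t.2 c t1 n1 v0 v'0 vv' dv; last by apply.
    by move: bt; rewrite ltNge H.
  exists t; last by split; exact: sub.
  rewrite mem_filter tl' andbT ltNge; apply/negP => ht; apply: nh.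
  by exists t.1, t.2; split; [split|exact: sub|exact: sub].
apply: (@le_trans _ _ (\sum_(t <- [seq t <- l | mass (line_strip v' t) < 4 * m]) (4 * m) ^+ 2)).
  rewrite big_seq [leRHS]big_seq; apply: ler_sum => t; rewrite mem_filter => /andP[tm _].
  by rewrite /S mass2_square lerXn2r ?nnegrE ?mass_ge0 ?(ltW tm) // mulr_ge0 // ltW.
rewrite big_const_seq count_predT iter_addr_0 -[leLHS]mulr_natl.
apply: (@le_trans _ _ ((size l)%:R * (4 * m) ^+ 2)).
  by rewrite ler_wpM2r ?sqr_ge0 // ler_nat size_filter count_size.
have -> : (size l)%:R * (4 * m) ^+ 2 = (size l)%:R * m * (16 * m) by ring.
apply: le_trans (_ : 2 * (16 * m) <= _); first by rewrite ler_wpM2r // mulr_ge0 // ltW.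
by rewrite mulrA -natrM.
Qed.

Lemma mass2_le_setU G G1 G2 : (forall x y, x \in P -> y \in P -> G x y -> G1 x y \/ G2 x y) ->
  mass2 G <= mass2 G1 + mass2 G2.
Proof.
move=> GG; have := @mass2_le_seq bool [:: true; false] (fun b => if b then G1 else G2) G.
rewrite !big_cons big_nil addr0; apply => x y xP yP /(GG x y xP yP)[h|h].
  by exists true.
by exists false.
Qed.

(* Each pair is close, or has an arc of a first scale at which it is not heavy,
   or becomes heavy at some first scale; the thresholds decrease geometrically so
   that the last two contributions are summable. *)
Lemma sqr_mass_le_scales (N : nat) (v r : nat -> R) (Theta : nat -> seq 'rV[R]_2) (b tau : R) :
  0 < s -> 0 < b -> b <= 1 -> delta <= tau ->
  (forall i, 0 < v i) -> (forall i, 0 < r i) ->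
  (forall n c, ~ heavy (b ^+ 2) (v 0) n c) ->
  (forall i, (i < N)%N -> [/\ delta <= v i.+1, delta <= 65 * r i.+1 / v i.+1 ^+ 2 &
     delta <= 17 * v i.+1 / v i]) ->
  (forall i, (i < N)%N -> 6 * v i.+1 <= v i) ->
  (forall i, (i < N)%N -> C * v i.+1 `^ s <= b ^+ 2 / 4 ^+ i.+1) ->
  (forall i, (i < N)%N -> (size (Theta i.+1))%:R ^+ 2 * (C * (65 * r i.+1 / v i.+1 ^+ 2) `^ s)
     <= b ^+ 2 / 4 ^+ i.+1) ->
  (forall i, (i < N)%N -> C * (17 * v i.+1 / v i) `^ s <= (b ^+ 2 / 4 ^+ i.+1) ^+ 2 / 9) ->
  (forall x y, x \in P -> y \in P -> ~ ball x tau y ->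
     exists2 i, (i < N)%N & arc_pair (Theta i.+1) (r i.+1) x y) ->
  mass setT ^+ 2 <= C * tau `^ s + (2 * b + 32 * b ^+ 2).
Proof.
move=> s0 b0 b1 dtau v0 r0 base dN vN Cv Tr Cvv arcs.
pose m i := b ^+ 2 / 4 ^+ i.
have p4 i : 1 <= (4 : R) ^+ i by rewrite exprn_ege1 // ler1n.
have p40 i : 0 < (4 : R) ^+ i by rewrite exprn_gt0.
have m0 i : 0 < m i by rewrite divr_gt0 // exprn_gt0.
have m1 i : m i <= 1.
  rewrite /m ler_pdivrMr // mul1r; apply: le_trans (p4 i).
  by rewrite expr_le1 // ltW.
have m4 i : m i = 4 * m i.+1.
  by rewrite /m [4 ^+ i.+1]exprS; have := p40 i; move: (4 ^+ i) => q q0; field; rewrite gt_eqF.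
pose D i x y := arc_pair (Theta i.+1) (r i.+1) x y /\ ~ heavy_pair (m i.+1) (v i.+1) x y.
pose E i x y := heavy_pair (m i.+1) (v i.+1) x y /\ ~ heavy_pair (m i) (v i) x y.
rewrite -mass2_square.
apply: (@le_trans _ _ (mass2 (fun x y => ball x tau y) +
   (mass2 (fun x y => exists2 i, i \in iota 0 N & D i x y) +
    mass2 (fun x y => exists2 i, i \in iota 0 N & E i x y)))).
  apply: le_trans (mass2_le_setU (G1 := fun x y => ball x tau y)
    (G2 := fun x y => ~ ball x tau y) _) _.
    by move=> x y _ _ _; have [h|h] := pselect (ball x tau y); [left|right].
  rewrite lerD2l; apply: mass2_le_setU => x y xP yP /(arcs x y xP yP)[i iN xy].
  have [hi|hi] := pselect (heavy_pair (m i.+1) (v i.+1) x y); last first.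
    by left; exists i; rewrite ?mem_iota.
  (* At the first scale where the pair is heavy it is newly heavy; [base] covers the case where the
     preceding scale is 0. *)
  right; have exj : exists j, `[< (j < N)%N /\ heavy_pair (m j.+1) (v j.+1) x y >].
    by exists i; apply/asboolP.
  case: (ex_minnP exj) => j /asboolP[jN hj] jmin.
  exists j; rewrite ?mem_iota //; split=> //; case: j jN hj jmin => [|j] jN hj jmin.
    by move=> [n [c [hn _ _]]]; apply: (base n c); move: hn; rewrite /m expr0 divr1.
  move=> hj'; have : (j.+1 <= j)%N; last by rewrite ltnn.
  by apply: jmin; apply/asboolP; split => //; exact: ltnW.
apply: lerD.
  rewrite /mass2; apply: (@le_trans _ _ (\sum_(x <- P) w x * (C * tau `^ s))).
    by apply: ler_sum => x _; rewrite ler_wpM2l // ball_le.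
  rewrite -mulr_suml -[leRHS]mul1r ler_wpM2r ?mulr_ge0 ?powR_ge0 //.
  apply: le_trans total_le1; rewrite /mass; apply: ler_sum => y _.
  by rewrite asboolT // mulr1.
have sumN (f : nat -> R) e : 0 < e -> (forall i, (i < N)%N -> f i <= e / 2 ^+ i.+1) ->
    \sum_(i <- iota 0 N) f i <= e.
  move=> e0 fe; apply: le_trans (sum_geom N e0).
  rewrite -[leRHS](big_mkord xpredT (fun k => e / 2 ^+ k.+1)) /index_iota subn0.
  rewrite big_seq [leRHS]big_seq; apply: ler_sum => i; rewrite mem_iota => /andP[_ iN].
  exact: fe.
apply: lerD.
  apply: le_trans (mass2_le_seq (l := iota 0 N) (H := D) _) _ => //.
  apply: sumN; first by rewrite mulr_gt0.
  move=> i iN; have [d1 d2 _] := dN i iN.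
  have := arc_pairs_mass2 s0 (v0 i.+1) (r0 i.+1) (m0 i.+1) d1 d2 (Cv i iN) (Tr i iN).
  have p20 : 0 < (2 : R) ^+ i.+1 by rewrite exprn_gt0.
  (* The thresholds are squares, so 3 m <= (2 b / 2^(i+1))^2 and the square roots remain
     summable. *)
  have mE : m i.+1 = (b / 2 ^+ i.+1) ^+ 2.
    by rewrite exprMn exprVn -exprM mulnC exprM -natrX.
  move=> H; rewrite -(ler_pXn2r (n := 2)) ?nnegrE //.
  - apply: le_trans H _; rewrite mE -mulrA [leRHS]exprMn ler_wpM2r ?sqr_ge0 //.
    by rewrite -natrX ler_nat.
  - by apply: sumr_ge0 => x _; rewrite mulr_ge0 // mass_ge0.
  - by rewrite divr_ge0 ?mulr_ge0 // ltW.
apply: le_trans (mass2_le_seq (l := iota 0 N) (H := E) _) _ => //.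
apply: sumN; first by rewrite mulr_gt0 // exprn_gt0.
move=> i iN; have [_ _ d3] := dN i iN.
have := heavy_pairs_mass2 (m0 i.+1) (m1 i.+1) (v0 i.+1) (v0 i) (vN i iN) d3 (Cvv i iN).
rewrite -m4 => /le_trans; apply; rewrite /m mulrA; apply: ler_wpM2l.
  by apply: mulr_ge0 => //; exact: sqr_ge0.
by rewrite lef_pV2 ?posrE ?exprn_gt0 // lerXn2r // ?nnegrE // ler_nat.
Qed.

End WeightedPoints.

(** * Compactness *)

Section UltraLimits.
Context {R : realType} (F : set_system nat) {FF : UltraFilter F}.

Lemma ultra_cvg_bounded (u : nat -> R) (B : R) : (forall n, `|u n| <= B) ->
  exists l : R, u @ F --> l.
Proof.
move=> uB; have /(_ (u @ F) _) := @segment_compact R (- B) B.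
case; first by apply: nearW => n; rewrite /= in_itv /= -ler_norml.
move=> l [_ lc]; exists l => A Al.
have [//|nA] := in_ultra_setVsetC (u @^-1` A) FF.
by have [x [nAx Ax]] := lc (~` A) A nA Al.
Qed.

Lemma cvg_coordP (y : nat -> 'rV[R]_2) (x : 'rV[R]_2) :
  (y @ F --> x) <-> (forall i, (fun n => y n 0 i) @ F --> x 0 i).
Proof.
split=> [yx i|yx].
  apply/cvgrPdist_lt => e e0.
  have : F [set n | ball x e (y n)] := yx _ (nbhsx_ballx x e e0).
  by apply: filterS => n /= [_ /(_ 0 i)].
move=> A; rewrite -nbhs_ballE => -[e /= e0 eA].
have h i : F [set n | `|x 0 i - y n 0 i| < e] by move: (yx i) => /cvgrPdist_lt /(_ e e0).
suff: F [set n | A (y n)] by []. 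
by apply: filterS2 (h 0) (h 1) => n h0 h1; apply: eA; apply/ball_coordP; split.
Qed.

Lemma ultra_cvg_row (y : nat -> 'rV[R]_2) (B : R) : (forall n i, `|y n 0 i| <= B) ->
  exists x : 'rV[R]_2, y @ F --> x.
Proof.
move=> yB; have /choice[l lP] i := ultra_cvg_bounded (yB ^~ i).
by exists (\row_i l i); apply/cvg_coordP => i; rewrite mxE.
Qed.

Lemma cvg_near_ball (y : nat -> 'rV[R]_2) (x a : 'rV[R]_2) (r : R) :
  y @ F --> x -> ball a r x -> F [set n | ball a r (y n)].
Proof.
move=> /cvg_coordP yx /ball_coordP[r0 a0 a1].
have near i : `|a 0 i - x 0 i| < r -> F [set n | `|a 0 i - y n 0 i| < r].
  by apply: cvgr_lt; apply: cvg_norm; apply: cvgB (yx i); exact: cvg_cst.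
by apply: filterS2 (near 0 a0) (near 1 a1) => n h0 h1; apply/ball_coordP.
Qed.

Lemma cvg_direction (x y : nat -> 'rV[R]_2) (a b : 'rV[R]_2) : a != b ->
  x @ F --> a -> y @ F --> b -> (fun n => direction (x n) (y n)) @ F --> direction a b.
Proof.
move=> ab /cvg_coordP xa /cvg_coordP yb; apply/cvg_coordP => i.
have dE (p q : 'rV[R]_2) : direction p q 0 i = (eucl_norm (p - q))^-1 * (p 0 i - q 0 i).
  by rewrite !mxE.
rewrite dE; under eq_fun do rewrite dE.
apply: cvgM; last by apply: cvgB.
apply: cvgV; first by rewrite gt_eqF // eucl_norm_gt0 // subr_eq0.
rewrite eucl_normE; under eq_fun do rewrite eucl_normE.
apply: (@continuous_cvg _ _ _ F _ (fun n => (x n - y n) 0 0 ^+ 2 + (x n - y n) 0 1 ^+ 2) Num.sqrt).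
  exact: sqrt_continuous.
apply: cvgD; rewrite expr2; under eq_fun do rewrite expr2 !mxE.
  by rewrite !mxE; apply: cvgM; apply: cvgB.
by rewrite !mxE; apply: cvgM; apply: cvgB.
Qed.

End UltraLimits.

Lemma cofinal_ultrafilter :
  exists F : set_system nat, UltraFilter F /\ forall m, F [set n | (m <= n)%N].
Proof.
have [F [UF sF]] := ultraFilterLemma eventually_filter.
exists F; split => // m; apply: sF; exact: nbhs_infty_ge.
Qed.

Lemma expr_small {R : realType} (x e : R) : 0 <= x -> x < 1 -> 0 < e ->
  exists N, forall n, (N <= n)%N -> x ^+ n <= e.
Proof.
move=> x0 x1 e0.
have : x ^+ n @[n --> \oo] --> (0 : R) by apply: cvg_expr; rewrite ger0_norm.
move=> /cvgrPdist_le /(_ e e0) [N _ HN]; exists N => n /HN /=.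
by rewrite sub0r normrN ger0_norm // exprn_ge0.
Qed.

Section Compactness.
Context {R : realType}.
Variables (E : set 'rV[R]_2) (K : nat -> set 'rV[R]_2).
Hypothesis E_close : forall x y i, E x -> E y -> `|x 0 i - y 0 i| <= 1.
Hypothesis K_decr : forall n, K n.+1 `<=` K n.
Hypothesis KE : forall n, K n `<=` E.
Hypothesis K_limit : forall F : set_system nat, UltraFilter F ->
  (forall m, F [set n | (m <= n)%N]) ->
  forall (y : nat -> 'rV[R]_2) (x : 'rV[R]_2), (forall n, K n (y n)) -> y @ F --> x -> E x.

Lemma K_le m n : (m <= n)%N -> K n `<=` K m.
Proof.
move=> /subnK <-; elim: (n - m)%N => // k IH x; rewrite addSn => /K_decr; exact: IH.
Qed.

Lemma E_bounded : exists B, forall x i, E x -> `|x 0 i| <= B.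
Proof.
have [[p Ep]|nE] := pselect (exists p, E p); last first.
  by exists 0 => x i Ex; case: nE; exists x.
exists (1 + Num.max `|p 0 0| `|p 0 1|) => x i Ex.
have -> : x 0 i = (x 0 i - p 0 i) + p 0 i by rewrite subrK.
apply: le_trans (ler_normD _ _) _; apply: lerD; first exact: E_close.
by rewrite le_max; move: i; apply: ord2P; rewrite lexx ?orbT.
Qed.

(** Otherwise pairs from [K N] at distance at least [tau] escape the first [N] arcs. Along an
    ultrafilter they converge to distinct points of [E]; the open arc containing the limit direction
    contains nearby directions as well, a contradiction. *)
Lemma finitely_many_arcs (a : nat -> 'rV[R]_2) (r : nat -> R) (tau : R) : 0 < tau ->
  spanned_directions E `<=` \bigcup_k ball (a k) (r k) ->
  exists N, forall x y, K N x -> K N y -> ~ ball x tau y ->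
    exists2 k, (k < N)%N & ball (a k) (r k) (direction x y).
Proof.
move=> tau0 Ear; apply: contrapT => /forallNP H.
have /choice[p pP] N : exists p : 'rV[R]_2 * 'rV[R]_2,
   [/\ K N p.1, K N p.2, ~ ball p.1 tau p.2 &
     forall k, (k < N)%N -> ~ ball (a k) (r k) (direction p.1 p.2)].
  apply: contrapT => /forallNP nP; apply: (H N) => x y Kx Ky xy.
  apply: contrapT => nk; apply: (nP (x, y)); split => // k kN kxy.
  by apply: nk; exists k.
have [K1 K2 ptau pk] := all_and4 pP.
have [B EB] := E_bounded.
have [F [UF Fc]] := cofinal_ultrafilter.
have [x px] := ultra_cvg_row (fun n i => EB _ i (KE (K1 n))).
have [y py] := ultra_cvg_row (fun n i => EB _ i (KE (K2 n))).
have Ex := K_limit UF Fc K1 px; have Ey := K_limit UF Fc K2 py.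
have xy : ~ ball x tau y.
  move=> /ball_coordP[_ xy0 xy1].
  move: px py => /cvg_coordP px /cvg_coordP py.
  have near i : `|x 0 i - y 0 i| < tau -> F [set n | `|(p n).1 0 i - (p n).2 0 i| < tau].
    by apply: cvgr_lt; apply: cvg_norm; apply: cvgB.
  have [n [h0 h1]] := filter_ex (filterI (near 0 xy0) (near 1 xy1)).
  by apply: (ptau n); apply/ball_coordP.
have nxy : x != y by apply/eqP => xy'; apply: xy; rewrite xy'; exact: ballxx.
have [|k _ kxy] := Ear (direction x y); first by exists x, y.
have near := @cvg_near_ball _ F UF _ _ _ _ (@cvg_direction _ F UF _ _ _ _ nxy px py) kxy.
have [n [/= kn]] := filter_ex (filterI (Fc k.+1) near); exact: pk.
Qed.

Variables (C s : R).
Hypothesis C_gt0 : 0 < C.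
Hypothesis s_gt0 : 0 < s.

(** Otherwise there are heavy strips of width tending to 0, converging along an ultrafilter to a
    line. A cheap cover of [E] on that line cannot carry the mass of the strips, so points of the
    strips escape the first [N] balls; their limit is in [E] and on the line, yet covered by an open
    ball. *)
Lemma light_strips (b : R) : 0 < b ->
  (forall (n : 'rV[R]_2) (c : R), n 0 0 ^+ 2 + n 0 1 ^+ 2 = 1 ->
     null_dim s (E `&` [set z | dot n z = c])) ->
  exists2 v : R, 0 < v & exists N, forall k (P : seq 'rV[R]_2) (w : 'rV[R]_2 -> R),
    (N <= k)%N -> (forall p, p \in P -> K k p) ->
    (forall x, 0 <= w x) ->
    (forall (a : 'rV[R]_2) (r : R), 2^-1 ^+ k <= r -> mass P w (ball a r) <= C * r `^ s) ->
    forall n c, ~ heavy P w b v n c.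
Proof.
move=> b0 nullE; apply: contrapT => H.
have rho1 : 2^-1 `^ s < 1 := half_powR_lt1 s_gt0.
have rho0 : 0 <= 2^-1 `^ s := powR_ge0 _ _.
(* The mass bound is available only from radius 2^(-k) on. Smaller balls are enlarged to it, and [k]
   is so large that [N] of these cost at most b / 4. *)
have small N : exists2 g, (N <= g)%N & N%:R * (C * (2^-1 `^ s) ^+ g) <= b / 4.
  have NC : 0 < N%:R * C + 1 by rewrite ltr_wpDl // mulr_ge0 // ltW.
  have [|g0 Hg] := expr_small rho0 rho1 (e := b / 4 / (N%:R * C + 1)).
    by rewrite !divr_gt0.
  exists (maxn N g0); first exact: leq_maxl.
  have := Hg (maxn N g0) (leq_maxr _ _); rewrite ler_pdivlMr //; apply: le_trans.
  by rewrite mulrA mulrC ler_wpM2l ?exprn_ge0 // lerDl.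
have bad N : exists t : nat * seq 'rV[R]_2 * ('rV[R]_2 -> R) * ('rV[R]_2 * R),
  let: (k, P, w, (n, c)) := t in
  [/\ (N <= k)%N /\ N%:R * (C * (2^-1 `^ s) ^+ k) <= b / 4, forall p, p \in P -> K k p,
    forall x, 0 <= w x,
    forall a r, 2^-1 ^+ k <= r -> mass P w (ball a r) <= C * r `^ s &
    heavy P w b N.+1%:R^-1 n c].
  have [g Ng gb] := small N.
  apply: contrapT => /forallNP nt; apply: H; exists N.+1%:R^-1; first by rewrite invr_gt0.
  exists g => k P w gk PK w0 wB n c hv; apply: (nt (k, P, w, (n, c))); split => //.
  split; first exact: leq_trans gk.
  apply: le_trans gb; rewrite ler_wpM2l // ler_wpM2l // ?(ltW C_gt0) //.
  by apply: ler_wiXn2l => //; exact: ltW.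
have [t tP] := choice bad.
pose nv N : 'rV[R]_2 := (t N).2.1; pose cv N : R := (t N).2.2.
have nu N : nv N 0 0 ^+ 2 + nv N 0 1 ^+ 2 = 1.
  by have := tP N; rewrite /nv; case: (t N) => [[[k P] w] [n c]] [_ _ _ _ []].
have [F [UF Fc]] := cofinal_ultrafilter.
have [n0 n0P] : exists n0 : 'rV[R]_2, nv @ F --> n0.
  apply: (@ultra_cvg_row _ _ _ _ 1) => N; have [h0 h1] := unit_coord (nu N).
  exact: ord2P.
have [B EB] := E_bounded.
have pt N : exists y, K N y /\ strip (nv N) (cv N) N.+1%:R^-1 y.
  have := tP N; rewrite /nv /cv; case: (t N) => [[[k P] w] [n c]] /= [[Nk _] PK w0 _ [_ hv]].
  have [[z zP zs]|nz] := pselect (exists2 z, z \in P & strip n c N.+1%:R^-1 z).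
    by exists z; split => //; exact: (K_le Nk (PK z zP)).
  have : mass P w (strip n c N.+1%:R^-1) = 0.
    rewrite /mass big_seq big1 // => p pP.
    by rewrite asboolF ?mulr0 // => Hp; apply: nz; exists p.
  by move: hv => /[swap] ->; rewrite leNgt b0.
have cB N : `|cv N| <= 2 * B + 1.
  have [y [/KE Ky]] := pt N; rewrite /strip /= => ys.
  have [h0 h1] := unit_coord (nu N).
  have d : `|dot (nv N) y| <= 2 * B.
    rewrite /dot; apply: le_trans (ler_normD _ _) _; rewrite !normrM.
    have -> : 2 * B = 1 * B + 1 * B by ring.
    by apply: lerD; apply: ler_pM => //; exact: EB.
  have v1 : N.+1%:R^-1 <= 1 :> R by rewrite invf_le1 // ler1n.
  move: (N.+1%:R^-1) v1 ys => e e1 ys.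
  move: ys d; rewrite !ler_norml => /andP[? ?] /andP[? ?];
    apply/andP; split; lra.
have [c0 c0P] := ultra_cvg_bounded cB.
have n0u : n0 0 0 ^+ 2 + n0 0 1 ^+ 2 = 1.
  have /cvg_coordP nn := n0P.
  have : (fun N => nv N 0 0 * nv N 0 0 + nv N 0 1 * nv N 0 1) @ F -->
      n0 0 0 * n0 0 0 + n0 0 1 * n0 0 1.
    by apply: cvgD; apply: cvgM.
  under eq_fun do rewrite -!expr2 nu.
  rewrite -!expr2 => l1.
  exact: (norm_cvg_unique l1 (cvg_cst _)).
have b4 : 0 < b / (4 * C) by rewrite divr_gt0 // mulr_gt0.
have [a [r [r0 Ear rt]]] := nullE n0 c0 n0u _ b4.
(* If the first [N] balls contained the points of the strip, its mass would be at most b / 4 from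
   the cover of the line and b / 4 from the enlargement. *)
have pt2 N : exists y, [/\ K N y, strip (nv N) (cv N) N.+1%:R^-1 y &
    forall l, (l < N)%N -> ~ ball (a l) (r l) y].
  have := tP N; rewrite /nv /cv; case: (t N) => [[[k P] w] [n c]] /= [[Nk kb] PK w0 wB [_ hv]].
  apply: contrapT => /forallNP ny.
  have : mass P w (strip n c N.+1%:R^-1) <= \sum_(l <- iota 0 N) mass P w (ball (a l) (r l)).
    apply: mass_le_seq => // p pP ps; apply: contrapT => np; apply: (ny p); split=> //.
      exact: (K_le Nk (PK p pP)).
    by move=> l lN lp; apply: np; exists l; rewrite ?mem_iota.
  have : \sum_(l <- iota 0 N) mass P w (ball (a l) (r l)) <=
      \sum_(l <- iota 0 N) (C * r l `^ s + C * (2^-1 `^ s) ^+ k).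
    apply: ler_sum => l _; have [kr|rk] := leP (2^-1 ^+ k) (r l).
      apply: le_trans (wB (a l) _ kr) _; rewrite lerDl mulr_ge0 ?exprn_ge0 //; exact: ltW.
    apply: (@le_trans _ _ (mass P w (ball (a l) (2^-1 ^+ k)))).
      by apply: mass_le => // p _; apply: le_ball; exact: ltW.
    apply: le_trans (wB (a l) _ (lexx _)) _; rewrite powR_exp // lerDr mulr_ge0 ?powR_ge0 //.
    exact: ltW.
  rewrite big_split /= -mulr_sumr big_const_seq count_predT size_iota iter_addr_0.
  rewrite -[X in _ + X]mulr_natl.
  have : C * \sum_(l <- iota 0 N) r l `^ s <= b / 4.
    have := rt N; rewrite -(big_mkord xpredT (fun l => r l `^ s)) /index_iota subn0 => rtN.
    apply: le_trans (_ : C * (b / (4 * C)) <= _); first by rewrite ler_wpM2l // ltW.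
    have -> : C * (b / (4 * C)) = b / 4 by field; rewrite gt_eqF.
    exact: lexx.
  move: hv kb; lra.
have [y yP] := choice pt2.
have [yK ys yl] := all_and3 yP.
have [x yx] := ultra_cvg_row (fun n i => EB _ i (KE (yK n))).
have Ex := K_limit UF Fc yK yx.
have dx : dot n0 x = c0.
  have dl : (fun N => `|dot (nv N) (y N) - cv N|) @ F --> `|dot n0 x - c0|.
    move: n0P yx => /cvg_coordP nn /cvg_coordP yy; apply: cvg_norm.
    by apply: cvgB => //; apply: cvgD; apply: cvgM.
  apply/eqP; rewrite -subr_eq0 -normr_le0 leNgt; apply/negP => d0.
  set d := `|dot n0 x - c0| in d0 dl.
  have d20 : 0 < d / 2 by rewrite divr_gt0.
  have d2 : d / 2 < d by lra.
  have near : F [set n | d / 2 < `|dot (nv n) (y n) - cv n|].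
    by move: d2; apply: cvgr_gt.
  have [m _ /(_ m (leqnn m)) /= md] := near_infty_natSinv_lt (PosNum d20).
  have [N [/= h mN]] := filter_ex (filterI near (Fc m)).
  move: (ys N); rewrite /strip /= leNgt => /negP; apply.
  apply: le_lt_trans h; apply: le_trans (ltW md).
  by rewrite lef_pV2 ?posrE // ler_nat ltnS.
have [l _ lx] := Ear x (conj Ex dx).
have near := @cvg_near_ball _ F UF _ _ _ _ yx lx.
have [n [/= ln]] := filter_ex (filterI (Fc l.+1) near); exact: yl.
Qed.

End Compactness.

(** * Choice of the scales *)

Section Scales.
Context {R : realType}.

Definition scale (r0 e : R) (i : nat) : R := r0 `^ ((1 + e) ^+ i).

Lemma bernoulli (e : R) i : 0 <= e -> 1 + i%:R * e <= (1 + e) ^+ i.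
Proof.
move=> e0; elim: i => [|i IH]; first by rewrite mul0r addr0 expr0.
rewrite exprS -natr1; have : 0 <= i%:R * (e * e) by rewrite !mulr_ge0.
have := ler_wpM2l (addr_ge0 ler01 e0) IH; lra.
Qed.

(** Since (1 + e)^i >= 1 + i e, the left side is at most D r0^g (r0^(g e))^i, and a small r0 makes
    the ratio at most 1/16. This ratio serves the condition involving the square of 4^(-i). *)
Lemma scale_decay (e g D eps : R) : 0 < e -> 0 < g -> 0 <= D -> 0 < eps ->
  exists2 rho : R, 0 < rho <= 1 & forall r0, 0 < r0 <= rho ->
    forall i, D * scale r0 e i `^ g <= eps / 16 ^+ i.
Proof.
move=> e0 g0 D0 eps0; have D10 : 0 < D + 1 by rewrite ltr_wpDl.
pose r1 := (eps / (D + 1)) `^ g^-1; pose r2 : R := 16^-1 `^ (g * e)^-1.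
have ge0 : 0 < g * e by rewrite mulr_gt0.
have r10 : 0 < r1 by rewrite powR_gt0 // divr_gt0.
have r20 : 0 < r2 by rewrite powR_gt0 // invr_gt0.
exists (Num.min 1 (Num.min r1 r2)); first by rewrite !lt_min ltr01 r10 r20 /= ge_min lexx.
move=> r0 /andP[r00]; rewrite !le_min => /andP[r01 /andP[rr1 rr2]] i.
have p1 : r0 `^ g <= eps / (D + 1).
  apply: le_trans (_ : r1 `^ g <= _).
    by apply: ge0_ler_powR; rewrite ?nnegrE // ltW.
  by rewrite /r1 -powRrM mulVf ?gt_eqF // powRr1 // divr_ge0 // ltW.
have p2 : r0 `^ (g * e) <= 16^-1.
  apply: le_trans (_ : r2 `^ (g * e) <= _).
    by apply: ge0_ler_powR; rewrite ?nnegrE // ltW.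
  by rewrite /r2 -powRrM mulVf ?gt_eqF // powRr1.
have -> : eps / 16 ^+ i = eps * (16^-1) ^+ i by rewrite exprVn.
apply: (@le_trans _ _ (D * (r0 `^ g * (r0 `^ (g * e)) ^+ i))).
  rewrite ler_wpM2l // /scale -powRrM -(powR_mulrn _ (powR_ge0 _ _)) -powRrM -powRD; last first.
    by rewrite (gt_eqF r00) implybT.
  apply: ger_powR; first by rewrite r00 r01.
  have -> : g + g * e * i%:R = (1 + i%:R * e) * g by ring.
  by rewrite ler_pM2r // bernoulli // ltW.
rewrite mulrA; apply: ler_pM; rewrite ?mulr_ge0 ?exprn_ge0 ?powR_ge0 //.
  apply: le_trans (_ : D * (eps / (D + 1)) <= _); first by rewrite ler_wpM2l.
  rewrite mulrA ler_pdivrMr // mulrC ler_pM2l //; lra.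
by apply: lerXn2r; rewrite ?nnegrE ?powR_ge0.
Qed.

Lemma scaleS (r0 e : R) i : scale r0 e i.+1 = scale r0 e i `^ (1 + e).
Proof. by rewrite /scale -powRrM exprSr. Qed.

Lemma scales (s t C b vmax : R) : 0 < t -> 2 * t < s -> 0 < C -> 0 < b -> 0 < vmax ->
  exists r v : nat -> R,
  [/\ forall i, 0 < r i <= v i, forall i, v i <= 1, forall i, r i.+1 <= r i,
      forall x, 0 < x -> exists i, r i <= x & v 0 <= vmax] /\
  [/\ forall i, 6 * v i.+1 <= v i,
      forall i, C * v i.+1 `^ s <= b ^+ 2 / 4 ^+ i.+1,
      forall i, C * (17 * v i.+1 / v i) `^ s <= (b ^+ 2 / 4 ^+ i.+1) ^+ 2 / 9 &
      forall i n, 0 <= n -> n * r i.+1 `^ t <= 1 ->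
        n ^+ 2 * (C * (65 * r i / v i ^+ 2) `^ s) <= b ^+ 2 / 4 ^+ i].
Proof.
move=> t0 ts C0 b0 vmax0.
have s0 : 0 < s by lra.
(* With this choice the exponent s - 2 t - 2 e (s + t), left when the arcs are counted in pairs
   against the small balls, is (s - 2 t) / 2 > 0. *)
pose e := (s - 2 * t) / (4 * (s + t)).
have st0 : 0 < 4 * (s + t) by rewrite mulr_gt0 // addr_gt0.
have e0 : 0 < e by rewrite divr_gt0 // subr_gt0.
have eE : e * (s + t) = (s - 2 * t) / 4 by rewrite /e; field; rewrite gt_eqF // addr_gt0.
have e1 : e <= 1.
  by rewrite /e ler_pdivrMr // mul1r; lra.
have b20 : 0 < b ^+ 2 by rewrite exprn_gt0.
have ee0 : 0 < e * e by rewrite mulr_gt0.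
(* Six conditions on the initial scale: the radii tend to 0, [v 0] is at most [vmax], then the four
   estimates of the second group in order. *)
have [rho1 /andP[rho10 rho11] H1] := scale_decay (g := 1) (D := 1) (eps := 1) e0 ltr01 ler01 ltr01.
have [rho2 /andP[rho20 rho21] H2] := scale_decay (g := e) (D := 1) (eps := vmax) e0 e0 ler01 vmax0.
have [rho3 /andP[rho30 rho31] H3] := scale_decay (g := e * e) (D := 6) (eps := 1) e0 ee0
  (ler0n _ 6) ltr01.
have b24 : 0 < b ^+ 2 / 4 by rewrite divr_gt0.
have [rho4 /andP[rho40 rho41] H4] := scale_decay (g := e * s) e0 (mulr_gt0 e0 s0) (ltW C0) b24.
have b44 : 0 < b ^+ 2 ^+ 2 / 144 by rewrite divr_gt0 // exprn_gt0.
have C17 : 0 <= C * 17 `^ s by rewrite mulr_ge0 ?powR_ge0 // ltW.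
have [rho5 /andP[rho50 rho51] H5] := scale_decay (g := e * e * s) e0 (mulr_gt0 ee0 s0) C17 b44.
have C65 : 0 <= C * 65 `^ s by rewrite mulr_ge0 ?powR_ge0 // ltW.
have g0 : 0 < (s - 2 * t) / 2 by rewrite divr_gt0 // subr_gt0.
have [rho6 /andP[rho60 rho61] H6] := scale_decay (g := (s - 2 * t) / 2) e0 g0 C65 b20.
pose r0 := Num.min rho1 (Num.min rho2 (Num.min rho3 (Num.min rho4 (Num.min rho5 rho6)))).
have r00 : 0 < r0 by rewrite !lt_min rho10 rho20 rho30 rho40 rho50.
have : r0 <= r0 by [].
rewrite {2}/r0 !le_min => /andP[r1 /andP[r2 /andP[r3 /andP[r4 /andP[r5 r6]]]]].
have r0r x : r0 <= x -> 0 < r0 <= x by move=> ->; rewrite r00.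
have {}H1 := H1 r0 (r0r _ r1); have {}H2 := H2 r0 (r0r _ r2).
have {}H3 := H3 r0 (r0r _ r3); have {}H4 := H4 r0 (r0r _ r4).
have {}H5 := H5 r0 (r0r _ r5); have {}H6 := H6 r0 (r0r _ r6).
have rp i : 0 < scale r0 e i by rewrite powR_gt0.
have rS := scaleS r0 e.
move: (scale r0 e) H1 H2 H3 H4 H5 H6 rp rS => r H1 H2 H3 H4 H5 H6 rp rS.
clear r0 r00 r1 r2 r3 r4 r5 r6 r0r.
have [v vE] : exists v : nat -> R, forall i, v i = r i `^ e by exists (fun i => r i `^ e).
have rl i : r i <= 1.
  have := H1 i; rewrite powRr1 ?(ltW (rp i)) // mul1r => /le_trans; apply.
  by rewrite mul1r invf_le1 ?exprn_gt0 // exprn_ege1 // ler1n.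
have rb i : 0 < r i <= 1 by rewrite rp rl.
have vp i : 0 < v i by rewrite vE powR_gt0.
have vS i : v i.+1 = v i * r i `^ (e * e).
  by rewrite !vE rS -powRrM mulrDl mul1r powRD // (gt_eqF (rp i)) implybT.
have vv i : v i.+1 / v i = r i `^ (e * e) by rewrite vS mulrC mulKf // gt_eqF.
have v1 i : v i <= 1.
  by rewrite vE -[leRHS](powRr0 (r i)); apply: ger_powR; rewrite ?rb // ltW.
have h16 i (x : R) : 0 <= x -> x / 16 ^+ i <= x / 4 ^+ i.
  move=> x0; rewrite ler_wpM2l // lef_pV2 ?posrE ?exprn_gt0 // lerXn2r // ?nnegrE //.
  by rewrite ler_nat.
have n16 i : 1 / 16 ^+ i <= 1 :> R.
  by rewrite mul1r invf_le1 ?exprn_gt0 // exprn_ege1 // ler1n.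
exists r, v; split; split.
- move=> i; rewrite rp /= vE -[leLHS](powRr1 (ltW (rp i))); exact: ger_powR.
- exact: v1.
- move=> i; rewrite rS -[leRHS](powRr1 (ltW (rp i))).
  by apply: ger_powR; rewrite ?rb // lerDl ltW.
- move=> x x0; have [|||N HN] := @expr_small R 16^-1 x => //; first by rewrite invf_lt1 // ltr1n.
  exists N; have := H1 N; rewrite powRr1 ?(ltW (rp N)) // mul1r => /le_trans; apply.
  by rewrite mul1r -exprVn HN.
- by have := H2 0%N; rewrite expr0 divr1 mul1r vE.
- move=> i; rewrite vS mulrCA ler_piMr ?(ltW (vp i)) //.
  by apply: le_trans (H3 i) _.
- move=> i; apply: (@le_trans _ _ (C * r i `^ (e * s))).
    rewrite (ler_pM2l C0) powRrM -vE.
    apply: ge0_ler_powR; first exact: ltW.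
    - by rewrite nnegrE ltW.
    - by rewrite nnegrE ltW.
    rewrite vS ler_piMr ?(ltW (vp i)) // -[leRHS](powRr0 (r i)).
    by apply: ger_powR; [exact: rb|exact: ltW].
  apply: le_trans (H4 i) _; apply: le_trans (h16 _ _ (ltW b24)) _.
  by rewrite -mulrA -invfM -exprS.
- move=> i; rewrite -mulrA vv powRM ?powR_ge0 // -powRrM mulrA.
  apply: le_trans (H5 i) _; rewrite le_eqVlt; apply/orP; left; apply/eqP.
  have -> : (16 : R) ^+ i = 4 ^+ i ^+ 2.
    by rewrite -exprM mulnC exprM; congr (_ ^+ _); rewrite -natrX.
  rewrite [4 ^+ i.+1]exprS; have : (4 : R) ^+ i != 0 by rewrite expf_neq0.
  by move: (4 ^+ i) => q q0; field.
- move=> i n n0 nr.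
  have ru : r i.+1 `^ t = r i `^ ((1 + e) * t) by rewrite rS -powRrM.
  (* The number of arcs, at most r_(i+1)^(-t), as a power of r_i. *)
  have nle : n <= r i `^ (- ((1 + e) * t)).
    by rewrite powRN -[leRHS]mul1r ler_pdivlMr -?ru // powR_gt0.
  have nz : (r i == 0) = false by rewrite gt_eqF.
  have -> : 65 * r i / v i ^+ 2 = 65 * r i `^ (1 - 2 * e).
    rewrite powRB; last by rewrite nz implybT.
    rewrite (powRr1 (ltW (rp i))) -mulrA; congr (_ * (_ / _)).
    by rewrite vE -(powR_mulrn _ (powR_ge0 _ _)) -powRrM mulrC.
  rewrite powRM ?powR_ge0 // -powRrM mulrA mulrCA.
  apply: (@le_trans _ _ (C * 65 `^ s *
      (r i `^ (- ((1 + e) * t)) ^+ 2 * r i `^ ((1 - 2 * e) * s)))).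
    rewrite [leLHS](_ : _ = C * 65 `^ s * (n ^+ 2 * r i `^ ((1 - 2 * e) * s))); last by ring.
    by rewrite ler_wpM2l // ler_wpM2r ?powR_ge0 // lerXn2r ?nnegrE ?powR_ge0.
  rewrite -powR_mulrn ?powR_ge0 // -powRrM -powRD ?nz ?implybT //.
  have -> : - ((1 + e) * t) * 2%:R + (1 - 2 * e) * s = (s - 2 * t) / 2.
    have -> : - ((1 + e) * t) * 2%:R + (1 - 2 * e) * s = s - 2 * t - 2 * (e * (s + t)) by ring.
    by rewrite eE; field.
  by apply: le_trans (H6 i) _; apply: h16; exact: ltW.
Qed.

End Scales.

(** * Conclusion *)

Section Main.
Context {R : realType}.
Implicit Types (E K : set 'rV[R]_2).

Lemma massE (P : seq 'rV[R]_2) w (A : set 'rV[R]_2) :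
  mass P w A = \sum_(p <- P | `[< A p >]) w p.
Proof.
rewrite /mass [RHS]big_mkcond /=; apply: eq_bigr => p _.
by case: ifP => _; rewrite ?mulr1 ?mulr0.
Qed.

Lemma spanned_directionsS E K : E `<=` K -> spanned_directions E `<=` spanned_directions K.
Proof. by move=> EK _ [x [y [/EK Kx /EK Ky xy ->]]]; exists x, y. Qed.

(** The order of choices matters: the bound on light strips fixes the scales, these fix the cover of
    the directions, compactness leaves finitely many arcs, and only then is the dyadic level [L] of
    the weights chosen. *)
Lemma null_dim_of_directions (s t : R) E : 0 < t -> 2 * t < s -> analytic E ->
  (forall x y, E x -> E y -> dyadic 0 x = dyadic 0 y) ->
  (forall (n : 'rV[R]_2) (c : R), n 0 0 ^+ 2 + n 0 1 ^+ 2 = 1 ->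
     null_dim s (E `&` [set z | dot n z = c])) ->
  null_dim t (spanned_directions E) -> null_dim s E.
Proof.
move=> t0 ts aE E0 nullE nullS; have s0 : 0 < s by lra.
apply: contrapT => nE.
pose h := net_content dyadic (2^-1 `^ s) E.
have h0 : 0 < h by rewrite ltNge; apply/negP => hE; apply: nE; exact: null_dim_net_content.
pose c := h / 2; have c0 : 0 < c by rewrite divr_gt0.
have ch : c < h by rewrite /c; lra.
have [K [K_decr KE cK K_limit]] := capacitability (powR_ge0 _ _) (@dyadic_nested R) aE E0 ch.
have E_close x y i : E x -> E y -> `|x 0 i - y 0 i| <= 1.
  by move=> Ex Ey; apply: ltW; apply: dyadic0_close; exact: E0.
pose C : R := 9 * 2 `^ s; have C0 : 0 < C by rewrite mulr_gt0 // powR_gt0.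
(* The final estimate is c^2 <= c^2 / 4 + 2 b + 32 b^2, the first term coming from [tau]; since the
   last two are at most 34 b <= 34 c^2 / 100, this is absurd. *)
pose b := Num.min 1 (c ^+ 2 / 100).
have c20 : 0 < c ^+ 2 by rewrite exprn_gt0.
have b0 : 0 < b by rewrite lt_min ltr01 divr_gt0.
have b1 : b <= 1 by rewrite ge_min lexx.
have bc : b <= c ^+ 2 / 100 by rewrite ge_min lexx orbT.
have [vmax vmax0 [N1 light]] := light_strips E_close K_decr KE K_limit
  C0 s0 (exprn_gt0 2 b0) nullE.
have [r [v [[rv v1 r_decr r_small v0max] [v6 Cv Cvv Crv]]]] := scales t0 ts C0 b0 vmax0.
have rp i : 0 < r i by have /andP[] := rv i.
have vp i : 0 < v i by have /andP[h1 h2] := rv i; exact: lt_le_trans h2.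
have r_le i j : (i <= j)%N -> r j <= r i.
  by move=> /subnK <-; elim: (j - i)%N => // k IH; apply: le_trans IH; rewrite addSn.
pose tau := (c ^+ 2 / (4 * C)) `^ s^-1.
have cC0 : 0 < c ^+ 2 / (4 * C) by rewrite divr_gt0 // mulr_gt0.
have tau0 : 0 < tau by rewrite powR_gt0.
have Ctau : C * tau `^ s = c ^+ 2 / 4.
  by rewrite /tau -powRrM mulVf ?gt_eqF // powRr1 ?(ltW cC0) //; field; rewrite gt_eqF.
(* A sum below (r_1 / 2)^t keeps every arc below scale r_1; a sum below 1 limits the number of arcs
   at each scale. *)
have e10 : 0 < Num.min 1 ((r 1 / 2) `^ t) by rewrite lt_min ltr01 powR_gt0 // divr_gt0.
have [a [q [q0 Saq qt]]] := nullS _ e10.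
have q1 l : q l < r 1.
  have : q l `^ t <= (r 1 / 2) `^ t.
    have := qt l.+1; rewrite big_ord_recr /= le_min => /andP[_]; apply: le_trans.
    by rewrite lerDr sumr_ge0 // => i _; rewrite powR_ge0.
  move=> H; apply: (@le_lt_trans _ _ (r 1 / 2)); last by have := rp 1; lra.
  rewrite leNgt; apply/negP => /(gt0_ltr_powR t0).
  by rewrite !nnegrE ?divr_ge0 ?(ltW (rp 1)) ?(ltW (q0 l)) // => /(_ isT isT); rewrite ltNge H.
have [N2 arcs] := finitely_many_arcs E_close KE K_limit tau0 Saq.
have [N Nq] : exists N, forall l, (l < N2)%N -> r N <= q l.
  elim: N2 {arcs} => [|n [N HN]]; first by exists 0%N.
  have [M HM] := r_small _ (q0 n).
  exists (maxn M N) => l; rewrite ltnS leq_eqVlt => /orP[/eqP ->|ln].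
    by apply: le_trans HM; apply: r_le; exact: leq_maxl.
  by apply: le_trans (HN l ln); apply: r_le; exact: leq_maxr.
pose Theta i := [seq a l | l <- iota 0 N2 & r i.+1 <= q l < r i].
have Theta_size i : (size (Theta i))%:R * r i.+1 `^ t <= 1.
  apply: (@le_trans _ _ (\sum_(l < N2) q l `^ t)); last first.
    by apply: le_trans (qt N2) _; rewrite ge_min lexx.
  rewrite -(big_mkord xpredT (fun l => q l `^ t)) /index_iota subn0.
  rewrite (bigID (fun l => r i.+1 <= q l < r i)) /= -[leLHS]addr0.
  apply: lerD; last by apply: sumr_ge0 => l _; exact: powR_ge0.
  rewrite size_map -[leRHS]big_filter.
  apply: (@le_trans _ _ (\sum_(l <- [seq l <- iota 0 N2 | r i.+1 <= q l < r i]) r i.+1 `^ t)).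
    by rewrite big_const_seq count_predT iter_addr_0 -[leRHS]mulr_natl.
  rewrite big_seq [leRHS]big_seq; apply: ler_sum => l; rewrite mem_filter => /andP[/andP[rq _] _].
  by apply: ge0_ler_powR; rewrite ?nnegrE // ltW.
have half1 : 2^-1 < 1 :> R by rewrite invf_lt1 // ltr1n.
have half0 : 0 <= 2^-1 :> R by rewrite invr_ge0.
have [|L0 HL0] := expr_small half0 half1 (e := Num.min tau (r N)).
  by rewrite lt_min tau0 rp.
(* Level [L] resolves [tau] and the finest scale [r N], and is late enough in the sequence [K] for
   both compactness lemmas. *)
pose L := maxn L0 (maxn N1 N2).
have N1L : (N1 <= L)%N by rewrite /L !leq_max leqnn orbT.
have N2L : (N2 <= L)%N by rewrite /L !leq_max leqnn !orbT.
have := HL0 L (leq_maxl _ _); rewrite le_min => /andP[Ltau LN].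
have KL0 x y : K L x -> K L y -> dyadic 0 x = dyadic 0 y.
  by move=> /KE Ex /KE Ey; exact: E0.
have [P0 [P0K KP0]] := dyadic_representatives L KL0.
have rho0 : 0 < 2^-1 `^ s :> R by rewrite powR_gt0 // invr_gt0.
have [P [w [PK w0 cP wP]]] :=
  finite_frostman rho0 (@dyadic_nested R) P0K KP0 (ltW (cK L)).
have P1 : \sum_(p <- P) w p <= 1.
  case: P PK {cP} wP => [|p P] PK wP; first by rewrite big_nil.
  have := wP 0%N (dyadic 0 p) (leq0n _); rewrite expr0; apply: le_trans.
  rewrite [leRHS]big_mkcond /= big_seq [leRHS]big_seq; apply: ler_sum => x xP.
  have -> : dyadic 0 x = dyadic 0 p by apply: KL0; apply: PK; rewrite // mem_head.
  by rewrite eqxx.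
have ballP (d : 'rV[R]_2) (u : R) : 2^-1 ^+ L <= u -> mass P w (ball d u) <= C * u `^ s.
  by move=> Lu; rewrite massE; apply: (ball_mass s0 w0 wP P1).
have massT : mass P w setT = \sum_(p <- P) w p.
  by rewrite massE; apply: eq_bigl => p; rewrite asboolT.
have P_close x y i : x \in P -> y \in P -> `|x 0 i - y 0 i| <= 1.
  by move=> /PK/KE Ex /PK/KE Ey; exact: E_close.
have mass1 : mass P w setT <= 1 by rewrite massT.
have Lr i : (i < N)%N -> 2^-1 ^+ L <= r i.+1 by move=> iN; apply: le_trans LN (r_le _ _ iN).
have := sqr_mass_le_scales w0 mass1 P_close (ltW C0) ballP (v := v) (r := r) (N := N)
  (Theta := Theta) s0 b0 b1 Ltau vp rp _ _ (fun i _ => v6 i) (fun i _ => Cv i)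
  (fun i _ => Crv i.+1 _ (ler0n _ _) (Theta_size i.+1)) (fun i _ => Cvv i) _.
have cm : c ^+ 2 <= mass P w setT ^+ 2.
  by rewrite massT lerXn2r ?nnegrE ?(ltW c0) // (le_trans (ltW c0)).
have b2 : b ^+ 2 <= b by rewrite expr2 ler_piMr // ltW.
move=> H; have : mass P w setT ^+ 2 <= C * tau `^ s + (2 * b + 32 * b ^+ 2); last first.
  rewrite Ctau; move: cm bc b2 c20; move: (mass _ _ _ ^+ 2) (c ^+ 2) (b ^+ 2) => m2 c2 b2'; lra.
apply: H.
- move=> n d [n1 hn]; apply: (light L P w N1L PK w0 ballP n d); split => //.
  by apply: le_trans hn _; apply: mass_le => // z _; rewrite /strip /= => /le_trans; apply.
- move=> i iN; have rL := Lr i iN; have /andP[_ rvi] := rv i.+1.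
  split; first exact: le_trans rL rvi.
    rewrite ler_pdivlMr ?exprn_gt0 //; apply: le_trans (_ : 2^-1 ^+ L * 1 <= _).
      by rewrite ler_wpM2l ?exprn_ge0 // expr_le1 // ltW.
    by have := rp i.+1; lra.
  rewrite ler_pdivlMr //; apply: le_trans (_ : 2^-1 ^+ L * 1 <= _).
    by rewrite ler_wpM2l // exprn_ge0.
  by have := vp i.+1; lra.
- move=> x y xP yP xy.
  have [l lN2 lxy] := arcs x y (K_le K_decr N2L (PK _ xP)) (K_le K_decr N2L (PK _ yP)) xy.
  have exi : exists i, r i.+1 <= q l.
    by exists N; apply: le_trans (Nq l lN2); exact: r_decr.
  (* The least index locates the scale of the arc; [q1] excludes index 0, so the arc belongs to some
     [Theta i.+1]. *)
  case: (ex_minnP exi) => -[|i] ri imin; first by move: (q1 l); rewrite ltNge ri.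
  have qi : q l < r i.+1 by rewrite ltNge; apply/negP => /imin; rewrite ltnn.
  exists i.
    apply: leq_trans (imin N _); first by [].
    by apply: le_trans (Nq l lN2); exact: r_decr.
  split; first by apply/eqP => xy'; apply: xy; rewrite xy'; exact: ballxx.
  exists (a l); last by apply: le_ball lxy; exact: ltW.
  by apply: map_f; rewrite mem_filter ri qi mem_iota.
Qed.

Lemma analytic_dyadic_cell (d : int * int) : analytic [set x : 'rV[R]_2 | dyadic 0 x = d].
Proof.
have cont i : continuous (fun x : 'rV[R]_2 => x 0 i) by exact: coord_continuous.
have strip_an i (n : int) : analytic [set x : 'rV[R]_2 | Num.floor (x 0 i) = n].
  have -> : [set x : 'rV[R]_2 | Num.floor (x 0 i) = n] =
      [set x | n%:~R <= x 0 i] `&` [set x | x 0 i < n%:~R + 1].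
    apply/seteqP; split => x /=.
      by move=> /floor_eq_itv /andP[].
    by move=> [h0 h1]; apply/eqP; rewrite floor_eq h0 intrD h1.
  apply: analytic_setI.
    apply: analytic_closed.
    exact: (preimage_closed (fun x _ => cont i x) (closed_ge (y := n%:~R))).
  apply: analytic_open.
  exact: ((continuousP _).1 (cont i) _ (@open_lt _ (n%:~R + 1))).
have -> : [set x : 'rV[R]_2 | dyadic 0 x = d] =
   [set x | Num.floor (x 0 0) = d.1] `&` [set x | Num.floor (x 0 1) = d.2].
  apply/seteqP; split => x; rewrite /dyadic /= !expr0 !mul1r; first by move=> <-.
  by move=> [-> ->]; case: d.
by apply: analytic_setI; exact: strip_an.
Qed.

Lemma off_line K (n : 'rV[R]_2) (c : R) : n 0 0 ^+ 2 + n 0 1 ^+ 2 = 1 ->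
  ~ (exists L, is_line L /\ K `<=` L) -> exists2 x, K x & dot n x != c.
Proof.
move=> n1 hL; apply: contrapT => nx; apply: hL.
pose u : 'rV[R]_2 := \row_(i < 2) (if i == 0 then - n 0 1 else n 0 0).
exists (line (c *: n) u); split.
  exists (c *: n), u; split => //; apply/eqP => u0.
  have e0 : u 0 0 = 0 by rewrite u0 mxE.
  have e1 : u 0 1 = 0 by rewrite u0 mxE.
  move: e0 e1 n1; rewrite !mxE /= => /eqP; rewrite oppr_eq0 => /eqP -> ->.
  by rewrite expr0n addr0 => /esym/eqP; rewrite oner_eq0.
move=> x Kx; have xc : dot n x = c.
  by apply/eqP; apply: contrapT => /negP ne; apply: nx; exists x.
(* Orthogonal decomposition of [x] along [n] and its rotation [u]. *)
exists (cross n x) => //; rewrite -xc.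
rewrite -[RHS]scale1r -n1; apply/rowP.
by apply: ord2P; rewrite !mxE /= /dot /cross; ring.
Qed.

End Main.

Lemma hausdorff_dim_le {R : realType} (n : nat) (A : set 'rV[R]_n) (s : R) :
  0 <= s -> hausdorff_measure s A = 0%E -> (hausdorff_dim A <= s%:E)%E.
Proof. by move=> s0 As; apply: ereal_inf_lbound; exists s. Qed.

(** [K] is cut into its countably many unit dyadic pieces. On each, the line hypothesis of
    [null_dim_of_directions] comes from [null_dim_line], applied to a point of [K] off the line;
    this even gives exponent [t] <= [s]. *)
Lemma null_dim_spanned_directions {R : realType} (s t : R) (K : set 'rV[R]_2) :
  0 < t -> 2 * t < s -> borel_set K -> ~ (exists L, is_line L /\ K `<=` L) ->
  null_dim t (spanned_directions K) -> null_dim s K.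
Proof.
move=> t0 ts hB hL nS; have s0 : 0 < s by lra.
have tls : t <= s by lra.
have cover : K `<=` \bigcup_m (K `&` [set x | pickle (dyadic 0 x) = m]).
  by move=> x Kx; exists (pickle (dyadic 0 x)).
apply: null_dim_sub cover _; apply: null_dim_bigcup => // m.
set E := K `&` _; have EK : E `<=` K by move=> x [].
have [[p Ep]|nE] := pselect (exists p, E p); last first.
  move=> e e0; exists (fun=> 0), (geom_radius s e); split.
  - by move=> k; exact: geom_radius_gt0.
  - by move=> x Ex; case: nE; exists x.
  - move=> N; under eq_bigr => k _ do rewrite geom_radius_powR //.
    exact: sum_geom.
have E0 x y : E x -> E y -> dyadic 0 x = dyadic 0 y.
  by move=> [_ /= xm] [_ /= ym]; apply: (pcan_inj pickleK); rewrite xm ym.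
have Ecell : E = K `&` [set x | dyadic 0 x = dyadic 0 p].
  apply/seteqP; split => x [Kx xm]; split => //=; first by apply: E0.
  by rewrite xm; have [_] := Ep.
apply: (null_dim_of_directions t0 ts) => //.
- rewrite Ecell; apply: analytic_setI; first exact: analytic_borel.
  exact: analytic_dyadic_cell.
- move=> n c n1; have [x Kx xc] := off_line c n1 hL.
  apply: (null_dim_le t0 tls).
  pose D := 2 * (1 + eucl_norm (p - x)).
  apply: (null_dim_line (D := D) t0 n1 xc Kx) nS.
  + by move=> y [/EK].
  + by move=> y [_].
  + move=> y [Ey _]; have near i : `|(y - x) 0 i| <= 1 + eucl_norm (p - x).
      have -> : (y - x) 0 i = (y 0 i - p 0 i) + (p - x) 0 i by rewrite !mxE; ring.
      apply: le_trans (ler_normD _ _) _; apply: lerD (coord_le_eucl_norm _ _).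
      by apply: ltW; apply: dyadic0_close; exact: E0.
    by apply: eucl_norm_le; exact: near.
- exact: null_dim_sub (spanned_directionsS EK) nS.
Qed.

Theorem corollary1p8 (R : realType) (K : set 'rV[R]_2)
    (hB : borel_set K)
    (hL : ~ exists L : set 'rV[R]_2, is_line L /\ K `<=` L) :
  ((2^-1)%:E * hausdorff_dim K <= hausdorff_dim (spanned_directions K))%E.
Proof.
rewrite leNgt; apply/negP => /ereal_inf_lt[_ [t0 [t00 H0] <-]] t0K.
(* An exponent strictly between 2 t0 and the dimension of [K], which may be infinite. *)
have [s0 ts sK] : exists2 s0, 2 * t0 < s0 & (s0%:E < hausdorff_dim K)%E.
  move: t0K; case: (hausdorff_dim K) => [d||].
  - rewrite -EFinM lte_fin => td; exists ((2 * t0 + d) / 2); last rewrite lte_fin; lra.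
  - by move=> _; exists (2 * t0 + 1); [lra|exact: ltry].
  - by rewrite gt0_muleNy ?lte_fin ?invr_gt0.
(* The midpoint of t0 and s0 / 2: positive even if t0 = 0, with room on both sides. *)
pose t := (2 * t0 + s0) / 4.
have t0t : t0 < t by rewrite /t; lra.
have tpos : 0 < t by apply: le_lt_trans t0t.
have t2s : 2 * t < s0 by rewrite /t; lra.
have s0pos : 0 < s0 by lra.
have nS := null_dim_hausdorff t00 t0t H0.
have HK := hausdorff_null_dim s0pos (null_dim_spanned_directions tpos t2s hB hL nS).
by move: sK; rewrite ltNge (hausdorff_dim_le (ltW s0pos) HK).
Qed.
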